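(* Let $G$ be an irreducible Artin-Tits group of spherical type, equipped with its classical Garside structure. There exist atoms $a,b\in G$ and an element $x_G\in G^0$ (i.e. $\inf(x_G)=0$) satisfying the following properties: (i) the left normal form and the right normal form of $x_G$ are the same (it is then called the normal form of $x_G$); (ii) $\iota(x_G)=\varphi(x_G)=a$, and the first and last factors of the normal form of $x_G$ are the only ones consisting of a single atom; (iii) the normal form of $x_G$ has two consecutive factors which are respectively $b^{-1}\Delta$ and $\tau(b^{-1})\Delta$; (iv) $\sup(x_G)$ is a multiple of $o(G)$; in other words, $\tau^{\sup(x_G)}=\mathrm{id}_G$, and $\Delta^{\sup(x_G)}$ is central.
   Context: Artin-Tits groups. A Coxeter matrix is a symmetric matrix $M=(m_{ij})_{1\leqslant i,j\leqslant n}$ of size $n\geqslant 2$ with $m_{ii}=1$, $m_{ij}\in\{2,3,\ldots,\infty\}$ for $i\neq j$, and (standing convention) with at least one off-diagonal $m_{ij}\geqslant 3$. Its Coxeter diagram is the graph with vertices $v_1,\ldots,v_n$ in which $v_i,v_j$ ($i\ne j$) are joined by an edge iff $m_{ij}\geqslant 3$. The Artin-Tits group $A_M$ is generated by $s_1,\ldots,s_n$ with relations $s_is_js_i\cdots=s_js_is_j\cdots$ ($m_{ij}$ alternating terms on each side) for all $i\ne j$ with $m_{ij}<\infty$. The Coxeter group $W_M$ is the quotient of $A_M$ obtained by adding the relations $s_i^2=1$. $A_M$ is of spherical type if $W_M$ is finite; it is irreducible if the Coxeter diagram of $M$ is connected. Classical Garside structure on $G=A_M$. $P$ is the submonoid of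 $G$ generated by $s_1,\ldots,s_n$ (the atoms). The prefix order $x\preccurlyeq y\Leftrightarrow x^{-1}y\in P$ and the suffix order $x\succcurlyeq y\Leftrightarrow xy^{-1}\in P$ are lattice orders. The Garside element $\Delta$ is the least common multiple of all atoms (for either order). Simple elements are the $s$ with $1\preccurlyeq s\preccurlyeq\Delta$. $\tau(x)=\Delta^{-1}x\Delta$, and $o(G)$ is the (finite) order of $\tau$. For $x\in G$: $\sup(x)=\min\{k: x\preccurlyeq\Delta^k\}$, $\inf(x)=\max\{k:\Delta^k\preccurlyeq x\}$, $\ell(x)=\sup(x)-\inf(x)$. $G^0=\{x\in G:\inf(x)=0\}$. Normal forms. A pair of simple elements $(s,t)$ is left-weighted if the $\preccurlyeq$-gcd of $s^{-1}\Delta$ and $t$ is $1$, and right-weighted if the $\succcurlyeq$-gcd of $s$ and $\Delta t^{-1}$ is $1$. Each $x$ with $\ell(x)=r\geqslant1$ is uniquely $x=\Delta^{\inf(x)}x_1\cdots x_r$ (left normal form) with $x_i$ simple, $\neq 1$, $x_1\ne\Delta$, consecutive pairs left-weighted; and uniquely $x=x'_r\cdots x'_1\Delta^{\inf(x)}$ (right normal form) with $x'_i$ simple, $\ne 1$, $x'_1\neq\Delta$, consecutive pairs right-weighted. Initial and final factors: $\iota(x)=\tau^{-\inf(x)}(x_1)$, $\varphi(x)=x_r$. *)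

(* Defs.v *)
From HB Require Import structures.
From mathcomp Require Import all_boot all_order all_algebra.
From mathcomp Require Import all_classical.

Set Implicit Arguments.
Unset Strict Implicit.
Unset Printing Implicit Defensive.

Import Order.TTheory GRing.Theory Num.Theory.

(* A letter (s, b) stands for s if b = false and for s^-1 if b = true. *)
Definition word (S : choiceType) := seq (S * bool).

Definition flip (S : choiceType) (x : S * bool) : S * bool := (x.1, ~~ x.2).

Definition inv_word (S : choiceType) (w : word S) : word S :=
  rev (map (@flip S) w).

Definition pos_word (S : choiceType) (w : seq S) : word S :=
  [seq (s, false) | s <- w].

Section Presentation.
Variables (S : choiceType) (R : word S -> word S -> Prop).

Inductive pres_eq : word S -> word S -> Prop :=
| pres_refl u : pres_eq u u
| pres_sym u v : pres_eq u v -> pres_eq v u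
| pres_trans v u w : pres_eq u v -> pres_eq v w -> pres_eq u w
| pres_rel p q u v : R u v -> pres_eq (p ++ u ++ q) (p ++ v ++ q)
| pres_cancel p q x : pres_eq (p ++ [:: x; flip x] ++ q) (p ++ q).

Definition pres_eqb : rel (word S) := fun u v => `[< pres_eq u v >].

Lemma pres_eqb_refl : reflexive pres_eqb.
Proof. by move=> u; apply/asboolP; exact: pres_refl. Qed.

Lemma pres_eqb_sym : symmetric pres_eqb.
Proof. by move=> u v; apply/asboolP/asboolP; exact: pres_sym. Qed.

Lemma pres_eqb_trans : transitive pres_eqb.
Proof.
by move=> v u w /asboolP uv /asboolP vw; apply/asboolP; exact: pres_trans vw.
Qed.

Canonical pres_equiv :=
  EquivRel pres_eqb pres_eqb_refl pres_eqb_sym pres_eqb_trans.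

Definition presented := {eq_quot pres_equiv}%qT.

HB.instance Definition _ := Choice.on presented.

Local Open Scope quotient_scope.

Definition pres_class (w : word S) : presented := \pi_presented w.

Lemma pres_classP u v : pres_class u = pres_class v <-> pres_eq u v.
Proof.
split=> [/eqP|uv]; last by apply/eqmodP/asboolP.
by rewrite /pres_class => /eqP/eqmodP/asboolP.
Qed.

Lemma pres_repr x : pres_class (repr x) = x.
Proof. exact: reprK. Qed.

Lemma pres_eq_catl p u v : pres_eq u v -> pres_eq (p ++ u) (p ++ v).
Proof.
elim=> {u v} [u|u v _|v u w _ uv _|r q u v uv|r q x].
- exact: pres_refl.
- exact: pres_sym.
- exact: pres_trans.
- by rewrite [p ++ _]catA [p ++ (r ++ v ++ q)]catA; exact: pres_rel.
- by rewrite [p ++ _]catA [p ++ (r ++ q)]catA; exact: pres_cancel.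
Qed.

Lemma pres_eq_catr p u v : pres_eq u v -> pres_eq (u ++ p) (v ++ p).
Proof.
elim=> {u v} [u|u v _|v u w _ uv _|r q u v uv|r q x].
- exact: pres_refl.
- exact: pres_sym.
- exact: pres_trans.
- by rewrite -!catA; exact: pres_rel.
- by rewrite -!catA; exact: pres_cancel.
Qed.

Lemma flipK : involutive (@flip S).
Proof. by case=> s b; rewrite /flip /= negbK. Qed.

Lemma inv_wordK : involutive (@inv_word S).
Proof. by move=> w; rewrite /inv_word map_rev revK mapK //; exact: flipK. Qed.

Lemma pres_eq_mulwV w : pres_eq (w ++ inv_word w) [::].
Proof.
elim: w => [|x w IHw]; first exact: pres_refl.
apply: (@pres_trans ([:: x] ++ [:: flip x])); last first.
  exact: (@pres_cancel [::] [::] x).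
have -> : (x :: w) ++ inv_word (x :: w) =
  [:: x] ++ ((w ++ inv_word w) ++ [:: flip x]).
  by rewrite /inv_word /= rev_cons -cats1 !catA.
exact/pres_eq_catl/(@pres_eq_catr _ _ [::]).
Qed.

Lemma pres_eq_mulVw w : pres_eq (inv_word w ++ w) [::].
Proof. by have := pres_eq_mulwV (inv_word w); rewrite inv_wordK. Qed.

Lemma pres_eq_inv u v : pres_eq u v -> pres_eq (inv_word u) (inv_word v).
Proof.
move=> uv; apply: (@pres_trans (inv_word u ++ (v ++ inv_word v))).
  rewrite -[X in pres_eq X _]cats0; apply/pres_eq_catl/pres_sym.
  exact: pres_eq_mulwV.
rewrite catA; apply: (@pres_eq_catr _ _ [::]).
apply: pres_trans (pres_eq_mulVw u).
exact/pres_eq_catl/pres_sym.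
Qed.

Definition pres_one : presented := pres_class [::].
Definition pres_mul (x y : presented) : presented :=
  pres_class (repr x ++ repr y).
Definition pres_inv (x : presented) : presented :=
  pres_class (inv_word (repr x)).

Lemma pres_repr_eq w : pres_eq (repr (pres_class w)) w.
Proof. by apply/pres_classP; rewrite pres_repr. Qed.

Lemma pres_mulE u v :
  pres_mul (pres_class u) (pres_class v) = pres_class (u ++ v).
Proof.
apply/pres_classP; apply: pres_trans.
  exact/pres_eq_catl/pres_repr_eq.
exact/pres_eq_catr/pres_repr_eq.
Qed.

Lemma pres_invE u : pres_inv (pres_class u) = pres_class (inv_word u).
Proof. exact/pres_classP/pres_eq_inv/pres_repr_eq. Qed.

Lemma pres_mulA : associative pres_mul.
Proof.
move=> x y z; rewrite -[x]pres_repr -[y]pres_repr -[z]pres_repr.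
by rewrite !pres_mulE catA.
Qed.

Lemma pres_mul1 : left_id pres_one pres_mul.
Proof. by move=> x; rewrite -[x]pres_repr pres_mulE. Qed.

Lemma pres_mulr1 : right_id pres_one pres_mul.
Proof. by move=> x; rewrite -[x]pres_repr pres_mulE cats0. Qed.

Lemma pres_mulV : left_inverse pres_one pres_inv pres_mul.
Proof.
move=> x; rewrite -[x]pres_repr pres_invE pres_mulE.
exact/pres_classP/pres_eq_mulVw.
Qed.

Lemma pres_mulrV : right_inverse pres_one pres_inv pres_mul.
Proof.
move=> x; rewrite -[x]pres_repr pres_invE pres_mulE.
exact/pres_classP/pres_eq_mulwV.
Qed.

HB.instance Definition _ := isGroup.Build presented
  pres_mulA pres_mul1 pres_mulr1 pres_mulV pres_mulrV.

End Presentation.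

(* An entry [None] stands for infinity. *)
Definition is_coxeter_matrix (n : nat) (M : 'M[option nat]_n) : Prop :=
  [/\ (2 <= n)%N,
      M^T%R = M,
      forall i, M i i = Some 1%N,
      forall i j m, i != j -> M i j = Some m -> (2 <= m)%N
    & exists i j, i != j /\ M i j <> Some 2%N].

Section ArtinTits.
Variables (n : nat) (M : 'M[option nat]_n).

Definition coxeter_edge : rel 'I_n := fun i j =>
  (i != j) && (if M i j is Some m then 3 <= m else true)%N.

Definition irreducible_type : Prop := forall i j, connect coxeter_edge i j.

Definition alternating (i j : 'I_n) (m : nat) : seq 'I_n :=
  mkseq (fun k => if odd k then j else i) m.

Inductive braid_rel : word 'I_n -> word 'I_n -> Prop :=
| BraidRel i j m of i != j & M i j = Some m :
    braid_rel (pos_word (alternating i j m)) (pos_word (alternating j i m)).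

Inductive coxeter_rel : word 'I_n -> word 'I_n -> Prop :=
| CoxeterBraid u v of braid_rel u v : coxeter_rel u v
| CoxeterSquare i : coxeter_rel (pos_word [:: i; i]) [::].

Definition artin := presented braid_rel.
HB.instance Definition _ := Group.on artin.

Definition coxeter := presented coxeter_rel.
HB.instance Definition _ := Group.on coxeter.

Definition spherical_type : Prop := finite_set [set: coxeter].

Definition gen (i : 'I_n) : artin :=
  pres_class braid_rel (pos_word [:: i]).

End ArtinTits.

Local Open Scope group_scope.

Section LeastGreatest.
Variables (T : Type) (le : T -> T -> Prop).

Definition is_gcd (x y d : T) : Prop :=
  [/\ le d x, le d y & forall z, le z x -> le z y -> le z d].

Definition is_lcm (A : set T) (d : T) : Prop :=
  (forall x, A x -> le x d) /\
  (forall z, (forall x, A x -> le x z) -> le d z).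

End LeastGreatest.

Definition expgz (G : groupType) (x : G) (k : int) : G :=
  match k with Posz m => x ^+ m | Negz m => x ^- m.+1 end.

Section Garside.
Variables (n : nat) (M : 'M[option nat]_n).
Local Notation G := (artin M).
Implicit Types (x y s t : G) (xs : seq G).

Definition atoms : set G := range (@gen n M).

Definition positive x : Prop :=
  exists w : seq 'I_n, x = \prod_(i <- w) gen M i.

Definition prefix_le x y : Prop := positive (x^-1 * y).

(* [suffix_le x y] says that x is a suffix of y; the usual suffix order puts
   the larger element on the left. *)
Definition suffix_le x y : Prop := positive (y * x^-1).

(* The lcm of the atoms exists when M is of spherical type; 1 is a junk value
   otherwise. *)
Definition Delta : G :=
  xget 1 [set d | is_lcm prefix_le atoms d /\ is_lcm suffix_le atoms d].

Definition simple s : Prop := prefix_le 1 s /\ prefix_le s Delta.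

Definition tau x : G := Delta^-1 * x * Delta.

Definition tauV x : G := Delta * x * Delta^-1.

Definition tauz (k : int) x : G :=
  match k with Posz m => iter m tau x | Negz m => iter m.+1 tauV x end.

Definition order_tau : nat :=
  xget 0%N [set d | [/\ (0 < d)%N, iter d tau =1 id
    & forall m, (0 < m)%N -> iter m tau =1 id -> (d <= m)%N]].

Definition gsup x : int :=
  xget 0%R [set k | prefix_le x (expgz Delta k) /\
    forall m, prefix_le x (expgz Delta m) -> (k <= m)%R].

Definition ginf x : int :=
  xget 0%R [set k | prefix_le (expgz Delta k) x /\
    forall m, prefix_le (expgz Delta m) x -> (m <= k)%R].

Definition glen x : int := (gsup x - ginf x)%R.

Definition left_weighted s t : Prop := is_gcd prefix_le (s^-1 * Delta) t 1.

Definition right_weighted s t : Prop := is_gcd suffix_le s (Delta * t^-1) 1.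

Definition is_left_nf x xs : Prop :=
  [/\ (0 < size xs)%N /\ glen x = (size xs)%:Z%R,
      x = expgz Delta (ginf x) * \prod_(s <- xs) s,
      forall s, s \in xs -> simple s /\ s <> 1,
      head 1 xs <> Delta
    & forall i, (i.+1 < size xs)%N ->
        left_weighted (nth 1 xs i) (nth 1 xs i.+1)].

(* [xs] lists the factors from left to right, so the factor written x'_1, next
   to the power of Delta, is the last one. *)
Definition is_right_nf x xs : Prop :=
  [/\ (0 < size xs)%N /\ glen x = (size xs)%:Z%R,
      x = (\prod_(s <- xs) s) * expgz Delta (ginf x),
      forall s, s \in xs -> simple s /\ s <> 1,
      last 1 xs <> Delta
    & forall i, (i.+1 < size xs)%N ->
        right_weighted (nth 1 xs i) (nth 1 xs i.+1)].

(* The default value is only reached when glen x < 1, where there is no normal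
   form. *)
Definition left_nf x : seq G := xget [::] [set xs | is_left_nf x xs].

Definition initial_factor x : G := tauz (- ginf x)%R (head 1 (left_nf x)).

Definition final_factor x : G := last 1 (left_nf x).

End Garside.

(* Main.v *)
(* Simple elements correspond to elements of the finite Coxeter group W, and a
   pair of simple elements (u, v) is both left- and right-weighted as soon as
   the right descent set of u is the left descent set of v. For a proper set I
   of atoms and an atom s outside I adjacent to I in the diagram, the element
   w_I s has left descent set I and right descent set s together with the t in I
   commuting with s. Viewing I as a set of tokens on the connected diagram,
   such moves lead from the complement of an atom b, which is the right descent
   set of tau(b)^-1 Delta = Delta b^-1, to a single atom a. The resulting
   sequence of simple elements, preceded by its mirror image, is the normal form
   of x_G; b^-1 Delta and tau(b)^-1 Delta stand in the middle, and the length is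
   even whereas tau^2 = 1.

   The Garside structure itself comes from W. The numbers game shows that
   s_i s_j has order exactly m_ij, and counting reflections modulo 2 gives the
   exchange condition, hence Matsumoto's theorem. Induction on the length then
   shows that a positive element divisible by two atoms is divisible by their
   lcm; the case of a chain of three distinct atoms is transported to W. Thus
   the braid monoid is cancellative, embeds in the group and has lcms, and Delta
   is the lift of the longest element of W. *)

Require Import Defs.
From mathcomp Require Import all_boot all_order all_algebra all_field.
From mathcomp Require Import all_classical.
From mathcomp Require Import ring zify.
From Stdlib Require Setoid Morphisms.

Set Implicit Arguments.
Unset Strict Implicit.
Unset Printing Implicit Defensive.

Import Order.TTheory GRing.Theory Num.Theory.

(** * Sliding tokens on a connected graph *)

Section Sliding.
Variables (T : finType) (e : rel T).
Hypothesis e_sym : symmetric e.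
Hypothesis e_irr : irreflexive e.
Hypothesis e_conn : forall x y, connect e x y.
Implicit Types (I J : {set T}) (s t : T).

(* Tokens sit on the vertices of I; sliding onto a free vertex s absorbs all
   tokens adjacent to s. *)
Definition slide s I := s |: [set t in I | ~~ e s t].

(** A move needs a token [t] adjacent to the free vertex [s]: it then absorbs at least one token, so
    moves never increase the number of tokens. *)
Inductive slides I : {set T} -> Prop :=
| slides_refl : slides I I
| slides_step s t J : s \notin I -> t \in I -> e s t ->
    slides (slide s I) J -> slides I J.

Lemma slides_trans I J K : slides I J -> slides J K -> slides I K.
Proof.
move=> h; elim: h K => {I J} [//|I s t J sI tI st _ IH] K /IH.
exact: slides_step tI st.
Qed.

Lemma slides1 I s t : s \notin I -> t \in I -> e s t -> slides I (slide s I).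
Proof.
by move=> sI tI st; apply: slides_step tI st _ => //; exact: slides_refl.
Qed.

Lemma slides_neq0 I J : slides I J -> I != finset.set0 -> J != finset.set0.
Proof.
elim=> {I J} // I s t J _ _ _ _ IH _; apply: IH.
by apply/set0Pn; exists s; rewrite setU11.
Qed.

Lemma card_slide I s : s \notin I ->
  (#|slide s I| + #|[set t in I | e s t]| = #|I|.+1)%N.
Proof.
move=> sI; rewrite /slide cardsU1 inE (negbTE sI) /= add1n addSn addnC.
rewrite -(cardsID [set t | e s t] I); congr (_ + _).+1; apply: eq_card => t;
  by rewrite !inE // andbC.
Qed.

Lemma card_slide_le I s t : s \notin I -> t \in I -> e s t ->
  (#|slide s I| <= #|I|)%N.
Proof.
move=> sI tI st; have := card_slide sI.
have : (0 < #|[set t in I | e s t]|)%N by apply/card_gt0P; exists t; rewrite inE tI.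
lia.
Qed.

Lemma card_slide_lt I s t t' : s \notin I -> t \in I -> t' \in I -> t != t' ->
  e s t -> e s t' -> (#|slide s I| < #|I|)%N.
Proof.
move=> sI tI t'I tt' st st'; have := card_slide sI.
have : (1 < #|[set t in I | e s t]|)%N.
  by apply/card_gt1P; exists t, t'; rewrite !inE tI t'I st st'.
lia.
Qed.

(** If no free vertex touched a token that has a token neighbour, the set [X] of such tokens would
    be closed under adjacency, hence everything by connectedness, although [I] is proper. *)
Lemma slides_boundary I t t' : t \in I -> t' \in I -> e t t' -> I != [set: T] ->
  exists s t1 t2, [/\ s \notin I, t1 \in I, t2 \in I, e s t1 & e t1 t2].
Proof.
move=> tI t'I tt' IT; pose X := [set x in I | [exists y in I, e x y]].
have tX : t \in X by rewrite inE tI; apply/existsP; exists t'; rewrite t'I.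
have [h|] := boolP [exists s, exists t1, exists t2,
    [&& s \notin I, t1 \in I, t2 \in I, e s t1 & e t1 t2]].
  case/existsP: h => s /existsP[t1 /existsP[t2 /and5P[? ? ? ? ?]]].
  by exists s, t1, t2.
move=> no; case/negP: IT; apply/eqP/setP => z; rewrite inE.
have cl : closed e (mem X).
  apply: (intro_closed (sym_connect_sym e_sym)) => x y xy.
  rewrite !inE => /andP[xI /existsP[w /andP[wI xw]]].
  have yI : y \in I.
    apply: contraR no => yI; apply/existsP; exists y; apply/existsP; exists x.
    by apply/existsP; exists w; rewrite yI xI wI e_sym xy xw.
  by rewrite yI; apply/existsP; exists x; rewrite xI e_sym.
have := closed_connect cl (e_conn t z); rewrite /= tX => /esym.
by rewrite inE => /andP[].
Qed.

(** Sliding onto [s] vacates [t1]. If [s] is adjacent to [t2] as well, two tokens merge at once;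
    otherwise sliding back onto [t1] absorbs both [s] and [t2]. *)
Lemma slides_adjacent I t t' : t \in I -> t' \in I -> e t t' -> I != [set: T] ->
  exists2 J, slides I J & (#|J| < #|I|)%N.
Proof.
move=> tI t'I tt' /(slides_boundary tI t'I tt')[s [t1 [t2 [sI t1I t2I st1 t12]]]].
have le := card_slide_le sI t1I st1.
have neq : t1 != t2 by apply: contraTneq t12 => ->; rewrite e_irr.
case: (boolP (e s t2)) => st2.
  exists (slide s I); first exact: slides1 t1I st1.
  exact: card_slide_lt t1I t2I neq st1 st2.
have sJ : s \in slide s I by rewrite setU11.
have t2J : t2 \in slide s I by rewrite !inE t2I st2 orbT.
have t1J : t1 \notin slide s I.
  by rewrite !inE st1 andbF orbF; apply: contraNneq sI => <-.
have t1s : e t1 s by rewrite e_sym.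
exists (slide t1 (slide s I)).
  by apply: slides_trans (slides1 sI t1I st1) (slides1 t1J sJ t1s).
apply: leq_trans le; apply: card_slide_lt sJ t2J _ t1s t12 => //.
by apply: contraNneq sI => ->.
Qed.

(** One token walks along the path towards the other. The count never grows, and it can be lowered
    as soon as one move absorbs both tokens or two tokens are adjacent. *)
Lemma slides_path x p I : path e x p -> x \in I -> last x p \in I ->
  x != last x p -> I != [set: T] -> exists2 J, slides I J & (#|J| < #|I|)%N.
Proof.
elim: p x I => [|s p IHp] x I /=; first by rewrite eqxx.
case/andP=> xs sp xI yI xy IT.
case: (boolP (s \in I)) => sI; first exact: slides_adjacent xI sI xs IT.
have sx : e s x by rewrite e_sym.
have le := card_slide_le sI xI sx.
have [sy|nsy] := boolP (e s (last s p)).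
  exists (slide s I); first exact: slides1 xI sx.
  exact: card_slide_lt xI yI xy sx sy.
have [| | | |J h lt] := IHp s (slide s I) sp.
- by rewrite setU11.
- by rewrite !inE yI nsy orbT.
- by apply: contraNneq sI => ->.
- apply/eqP => /setP/(_ x); rewrite !inE sx andbF orbF => /eqP xe.
  by rewrite -xe xI in sI.
exists J; last exact: leq_trans lt le.
exact: slides_trans (slides1 sI xI sx) h.
Qed.

Lemma slides_singleton I : I != finset.set0 -> I != [set: T] ->
  exists a, slides I [set a].
Proof.
have [k] := ubnP #|I|; elim: k I => // k IHk I Ik I0 IT.
case/set0Pn: (I0) => x xI.
have [/cards1P[a ->]|I1] := boolP (#|I| == 1).
  by exists a; exact: slides_refl.
have /card_gt1P[x' [y [x'I yI xy]]] : (1 < #|I|)%N.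
  by rewrite ltn_neqAle eq_sym I1 card_gt0.
have /connectP[p ep ey] := e_conn x' y; rewrite ey in xy yI.
have [J IJ lt] := slides_path ep x'I yI xy IT.
have [||a Ja] := IHk J (leq_trans lt Ik).
- exact: slides_neq0 IJ I0.
- by apply: contraTneq lt => ->; rewrite cardsT -leqNgt max_card.
by exists a; exact: slides_trans IJ Ja.
Qed.
End Sliding.

Local Open Scope group_scope.

(** * Coxeter groups *)

Arguments alternating : simpl never.

Section Alternating.
Variable n : nat.
Implicit Types (i j : 'I_n) (m : nat).

Lemma size_alt i j m : size (alternating i j m) = m.
Proof. exact: size_mkseq. Qed.

Lemma altS i j m : alternating i j m.+1 = i :: alternating j i m.
Proof.
rewrite /alternating /mkseq /= -[1%N]addn0 iotaDl -map_comp.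
by congr cons; apply: eq_map => k /=; case: (odd k).
Qed.

Lemma alt_cat i j a b :
  alternating i j (a + b) =
  alternating i j a ++ (if odd a then alternating j i b else alternating i j b).
Proof.
elim: a i j => [//|a IHa] i j.
by rewrite addSn !altS IHa /=; case: (odd a).
Qed.

Lemma altSr i j m :
  alternating i j m.+1 = rcons (alternating i j m) (if odd m then j else i).
Proof. by rewrite -addn1 alt_cat -cats1; case: (odd m). Qed.

Lemma rev_alt i j m :
  rev (alternating i j m) =
  if odd m then alternating i j m else alternating j i m.
Proof.
elim: m => [//|m IHm].
by rewrite {1}altSr rev_rcons IHm /=; case: (odd m) => /=; rewrite -altS.
Qed.

Lemma alt_double i j m :
  alternating i j (m + m) = alternating i j m ++ rev (alternating j i m).
Proof. by rewrite alt_cat rev_alt; case: (odd m). Qed.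

Lemma alt_letters i j m x : x \in alternating i j m -> x = i \/ x = j.
Proof.
by case/mapP => k _ ->; case: (odd k); [right|left].
Qed.
End Alternating.

Lemma finite_set_bound (T : choiceType) (f : T -> nat) :
  finite_set [set: T]%classic -> exists N, forall x, (f x <= N)%N.
Proof.
case/finite_seqP=> e he; exists (\max_(x <- e) f x)%N => x.
have xe : x \in e by have : [set: T]%classic x by []; rewrite he.
by rewrite (big_rem x) //= leq_maxl.
Qed.

Lemma finite_expg (G : groupType) (x : G) :
  finite_set [set: G]%classic -> exists2 k, (0 < k)%N & x ^+ k = 1.
Proof.
case/finite_seqP=> e he.
have ge y : y \in e by have : [set: G]%classic y by []; rewrite he.
apply: contrapT => hk.
have inj : injective (fun k => x ^+ k).
  suff lt k l : (k < l)%N -> x ^+ k <> x ^+ l.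
    by move=> k l /= e1; case: (ltngtP k l) => // /lt; rewrite e1.
  move=> kl e1; apply: hk; exists (l - k)%N; first by rewrite subn_gt0.
  by rewrite expgnFr ?(ltnW kl) // e1 mulgV.
have := @uniq_leq_size _ [seq x ^+ k | k <- iota 0 (size e).+1] e.
rewrite map_inj_uniq // iota_uniq size_map size_iota ltnn.
by move=> /(_ isT (fun y _ => ge y)).
Qed.

Section Coxeter.
Variables (n : nat) (M : 'M[option nat]_n).
Implicit Types (i j : 'I_n) (u v w : seq 'I_n).

Definition refl i : coxeter M := pres_class (coxeter_rel M) (pos_word [:: i]).
Definition wprod u : coxeter M := \prod_(i <- u) refl i.

Lemma map_fst_pos u : map fst (pos_word u) = u.
Proof. by rewrite -map_comp map_id. Qed.

Lemma wprod_cat u v : wprod (u ++ v) = wprod u * wprod v.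
Proof. exact: big_cat. Qed.

Lemma wprod_cons i u : wprod (i :: u) = refl i * wprod u.
Proof. exact: big_cons. Qed.

Lemma wprod_nil : wprod [::] = 1.
Proof. exact: big_nil. Qed.

Lemma wprod1 i : wprod [:: i] = refl i.
Proof. by rewrite wprod_cons wprod_nil mulg1. Qed.

Lemma wprodE u : wprod u = pres_class (coxeter_rel M) (pos_word u).
Proof.
elim: u => [|i u IHu]; first exact: wprod_nil.
by rewrite wprod_cons IHu; exact: pres_mulE.
Qed.

(** An induction principle for equality in W on positive words: forgetting the signs of the letters
    turns a cancellation into the deletion of a square. *)
Lemma cox_lift (Q : seq 'I_n -> seq 'I_n -> Prop) :
  (forall u, Q u u) -> (forall u v, Q u v -> Q v u) ->
  (forall u v w, Q u v -> Q v w -> Q u w) ->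
  (forall p u v q, Q u v -> Q (p ++ u ++ q) (p ++ v ++ q)) ->
  (forall i j m, i != j -> M i j = Some m ->
     Q (alternating i j m) (alternating j i m)) ->
  (forall i, Q [:: i; i] [::]) ->
  forall u v, wprod u = wprod v -> Q u v.
Proof.
move=> Qr Qs Qt Qc Qb Qi u v; rewrite !wprodE => /pres_classP uv.
rewrite -[u]map_fst_pos -[v]map_fst_pos.
elim: uv => {u v} [u|u v _|v u w _ uv _|p q u v uv|p q x].
- exact: Qr.
- exact: Qs.
- exact: Qt.
- rewrite !map_cat; apply: Qc; case: uv => {u v} [u v []|i] /=.
    by move=> i j m ij Mij; rewrite !map_fst_pos; exact: Qb.
  exact: Qi.
- by rewrite !map_cat; apply: (Qc _ _ [::]); exact: Qi.
Qed.

Lemma refl_sq i : refl i * refl i = 1.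
Proof.
have <- : wprod [:: i; i] = 1.
  rewrite wprodE; apply/pres_classP.
  exact: (@pres_rel _ _ [::] [::] _ _ (CoxeterSquare M i)).
by rewrite wprod_cons wprod1.
Qed.

Lemma reflV i : (refl i)^-1 = refl i.
Proof. exact: mulg1_eq (refl_sq i). Qed.

Lemma wprod_rev u : wprod (rev u) = (wprod u)^-1.
Proof.
elim: u => [|i u IHu]; first by rewrite wprod_nil invg1.
by rewrite rev_cons -cats1 wprod_cat wprod1 wprod_cons invgM IHu reflV.
Qed.

Lemma wprod_braid i j m : i != j -> M i j = Some m ->
  wprod (alternating i j m) = wprod (alternating j i m).
Proof.
move=> ij Mij; rewrite !wprodE; apply/pres_classP.
rewrite -[X in pres_eq _ X _]cats0 -[X in pres_eq _ _ X]cats0.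
by apply: (@pres_rel _ _ [::] [::]); constructor; constructor.
Qed.

Lemma wprod_surj (x : coxeter M) : exists u, x = wprod u.
Proof.
rewrite -[x]pres_repr; elim: (repr x) => [|[i b] w [u hu]].
  by exists [::]; rewrite wprod_nil.
exists (i :: u); rewrite wprod_cons -hu -cat1s -(pres_mulE).
congr (_ * _); case: b => //; rewrite -reflV.
exact: esym (pres_invE _ (pos_word [:: i])).
Qed.

End Coxeter.

(** * The order of a product of two generators *)

Section NumbersGame.
Variables (n : nat) (M : 'M[option nat]_n).
Hypothesis hM : is_coxeter_matrix M.
Implicit Types (i j k : 'I_n) (u v w : seq 'I_n).
Local Open Scope ring_scope.

Lemma Msym i j : M i j = M j i.
Proof. by case: hM => _ h _ _ _; rewrite -[in LHS]h mxE. Qed.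

Lemma Mge2 i j m : i != j -> M i j = Some m -> (2 <= m)%N.
Proof. by case: hM => _ _ _ h _; exact: h. Qed.

Lemma prim_root_ex m : {z : algC | (0 < m)%N -> m.-primitive_root z}.
Proof.
case: m => [|m]; first by exists 1.
by have [z hz] := C_prim_root_exists (ltn0Sn m); exists z.
Qed.

(** The scalar 2 stands for infinity because it is not a root of unity. *)
Definition bond_scalar (o : option nat) : algC :=
  if o is Some m then sval (prim_root_ex m) else 2.

Definition zeta i j : algC :=
  if (i < j)%N then bond_scalar (M i j) else (bond_scalar (M i j))^-1.

Lemma bond_scalar_neq0 i j : i != j -> bond_scalar (M i j) != 0.
Proof.
move=> ij; rewrite /bond_scalar; case E: (M i j) => [m|]; last by rewrite pnatr_eq0.
have m0 : (0 < m)%N := ltnW (Mge2 ij E).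
by case: prim_root_ex => z /= /(_ m0) /prim_root_eq0 ->; rewrite -lt0n.
Qed.

Lemma zeta_exp1 i j l : i != j ->
  (zeta i j ^+ l == 1) = if M i j is Some m then (m %| l)%N else (l == 0)%N.
Proof.
move=> ij; have -> : (zeta i j ^+ l == 1) = (bond_scalar (M i j) ^+ l == 1).
  by rewrite /zeta; case: ifP => // _; rewrite exprVn invr_eq1.
rewrite /bond_scalar; case E: (M i j) => [m|].
  have m0 : (0 < m)%N := ltnW (Mge2 ij E).
  by case: prim_root_ex => z /= /(_ m0) hz; rewrite -(prim_order_dvd hz).
by rewrite -natrX pnatr_eq1 -(expn0 2) eqn_exp2l.
Qed.

Lemma zeta_neq1 i j : i != j -> zeta i j != 1.
Proof.
move=> ij; have := zeta_exp1 1 ij; rewrite expr1 => ->.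
case E: (M i j) => [m|] //.
by have := Mge2 ij E; rewrite dvdn1; case: m {E} => [|[|m]].
Qed.

Lemma zeta_neq0 i j : i != j -> zeta i j != 0.
Proof.
by move=> /bond_scalar_neq0 h; rewrite /zeta; case: ifP; rewrite ?invr_eq0.
Qed.

Lemma zetaC i j : i != j -> zeta j i = (zeta i j)^-1.
Proof.
move=> ij; rewrite /zeta Msym; case: (ltngtP i j) => [||/val_inj] //.
  by rewrite invrK.
by move=> e; rewrite e eqxx in ij.
Qed.

(* Mozes' numbers game, i.e. the contragredient geometric representation, with
   edge weights chosen so that c i k * c k i = 2 + zeta + zeta^-1
   = 4 cos^2 (pi / m). *)
Definition fire i (f : 'I_n -> algC) : 'I_n -> algC :=
  fun k => if k == i then - f i else f k + (1 + zeta i k) * f i.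

Lemma fireK i : involutive (fire i).
Proof.
move=> f; apply/funext=> k; rewrite /fire eqxx; case: eqP => [->|_].
  by rewrite opprK.
by ring.
Qed.

Definition fires u f := foldr fire f u.

Lemma fires_cat u v f : fires (u ++ v) f = fires u (fires v f).
Proof. exact: foldr_cat. Qed.

Lemma fires_rev u : cancel (fires u) (fires (rev u)).
Proof.
elim: u => [//|i u IHu] f.
by rewrite rev_cons -cats1 fires_cat /= fireK IHu.
Qed.

Lemma fires_alt2 i j l f :
  fires (alternating i j (l + l)) f = iter l (fire i \o fire j) f.
Proof. by elim: l => [//|l IHl]; rewrite addSn addnS !altS /= IHl. Qed.

Section Pair.
Variables i j : 'I_n.
Hypothesis ij : i != j.
Local Notation z := (zeta i j).

Lemma fire2E f : [/\ fire i (fire j f) i = - (f i + (1 + z^-1) * f j),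
  fire i (fire j f) j = - f j + (1 + z) * (f i + (1 + z^-1) * f j)
  & forall k, k != i -> k != j -> fire i (fire j f) k =
      f k + (1 + zeta j k) * f j + (1 + zeta i k) * (f i + (1 + z^-1) * f j)].
Proof.
have ji : (j == i) = false by apply/negbTE; rewrite eq_sym.
rewrite /fire !eqxx (negbTE ij) ji (zetaC ij); split=> // k.
by move=> /negbTE -> /negbTE ->.
Qed.

(** [eig1], [eig2] and [eig3 k] are linear functionals that [fire i \o fire j] multiplies by z, z^-1
    and 1. The first two remain independent when m = 2 and z = z^-1, since z differs from 1. *)
Definition eig1 (f : 'I_n -> algC) := f j + f i.
Definition eig2 (f : 'I_n -> algC) := z^-1 * f j + f i.
Definition eig3 k (f : 'I_n -> algC) :=
  let q := 1 + zeta i k in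
  let a := (1 + zeta j k + q * z^-1) / (z^-1 - 1) in
  f k + a / (1 - z^-1) * eig2 f + (q - a) / (1 - z) * eig1 f.

Lemma eig1_fire f : eig1 (fire i (fire j f)) = z * eig1 f.
Proof.
rewrite /eig1; have [-> -> _] := fire2E f; have z0 := zeta_neq0 ij.
by field.
Qed.

Lemma eig2_fire f : eig2 (fire i (fire j f)) = z^-1 * eig2 f.
Proof.
rewrite /eig2; have [-> -> _] := fire2E f; have z0 := zeta_neq0 ij.
by field.
Qed.

Lemma eig3_fire k f : k != i -> k != j -> eig3 k (fire i (fire j f)) = eig3 k f.
Proof.
move=> ki kj; rewrite /eig3 eig1_fire eig2_fire.
have [_ _ ->] := fire2E f => //; rewrite /eig1 /eig2.
have z0 := zeta_neq0 ij; have z1 := zeta_neq1 ij.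
have z1' : 1 - z != 0 by rewrite subr_eq0 eq_sym.
have z1'' : z - 1 != 0 by rewrite subr_eq0.
by field; rewrite z0 z1' z1''.
Qed.

Lemma iter_eig l f :
  [/\ eig1 (iter l (fire i \o fire j) f) = z ^+ l * eig1 f,
      eig2 (iter l (fire i \o fire j) f) = z^-1 ^+ l * eig2 f
    & forall k, k != i -> k != j ->
      eig3 k (iter l (fire i \o fire j) f) = eig3 k f].
Proof.
elim: l => [|l [IH1 IH2 IH3]]; first by rewrite !expr0 !mul1r.
rewrite /= eig1_fire eig2_fire IH1 IH2 !exprS !mulrA; split=> // k ki kj.
by rewrite eig3_fire // IH3.
Qed.

Lemma iter_fire_id l f : z ^+ l = 1 -> iter l (fire i \o fire j) f = f.
Proof.
move=> zl; have [] := iter_eig l f; rewrite exprVn zl invr1 !mul1r.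
set g := iter l _ f => h1 h2 h3; have z1 := zeta_neq1 ij.
have z1' : z^-1 - 1 != 0 by rewrite subr_eq0 invr_eq1.
have gj : g j = f j.
  apply: (mulfI z1'); rewrite !mulrBl !mul1r.
  have e x : z^-1 * x j - x j = eig2 x - eig1 x by rewrite /eig1 /eig2; ring.
  by rewrite !e h1 h2.
have gi : g i = f i by move: h1; rewrite /eig1 gj => /addrI.
apply/funext=> k; case: (eqVneq k i) => [-> //|ki].
case: (eqVneq k j) => [-> //|kj].
by have := h3 k ki kj; rewrite /eig3 h1 h2 => /addIr /addIr.
Qed.

Lemma iter_fire_order l :
  (forall f, iter l (fire i \o fire j) f = f) -> z ^+ l = 1.
Proof.
(* On the constant function 1 the functional [eig1] is 2, so the eigenvalue z^l must be 1. *)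
move=> /(_ (fun=> 1)) h; have [+ _ _] := iter_eig l (fun=> 1); rewrite h.
have e0 : eig1 (fun=> 1) != 0 by rewrite /eig1 -(natrD _ 1 1) pnatr_eq0.
by rewrite -{1}[eig1 _]mul1r => /(mulIf e0).
Qed.

End Pair.

Lemma fires_wprod u v : wprod M u = wprod M v -> forall f, fires u f = fires v f.
Proof.
move: u v; apply: (@cox_lift n M (fun u v => forall f, fires u f = fires v f)).
- by [].
- by move=> u v uv f.
- by move=> u v w uv vw f; rewrite uv.
- by move=> p u v q uv f; rewrite !fires_cat uv.
- move=> i j m ij Mij f.
  have := fires_cat (alternating i j m) (rev (alternating j i m))
    (fires (alternating j i m) f).
  rewrite fires_rev -alt_double fires_alt2 iter_fire_id //.
  by apply/eqP; rewrite zeta_exp1 // Mij dvdnn.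
- by move=> i f /=; rewrite fireK.
Qed.

Lemma cox_order i j l : i != j -> ((refl M i * refl M j) ^+ l = 1)%g ->
  if M i j is Some m then (m %| l)%N else (l == 0)%N.
Proof.
move=> ij h; rewrite -zeta_exp1 //; apply/eqP; apply: iter_fire_order => // f.
rewrite -fires_alt2 -[RHS]/(fires [::] f); apply: fires_wprod.
rewrite wprod_nil -h; elim: l {h} => [|l IHl]; first exact: wprod_nil.
by rewrite addSn addnS !altS !wprod_cons IHl expgS mulgA.
Qed.

End NumbersGame.

(** * The exchange condition *)

Lemma cat_delete (T : Type) (u v a b : seq T) x : u ++ v = a ++ x :: b ->
  (exists b', u = a ++ x :: b' /\ b = b' ++ v) \/
  (exists a', v = a' ++ x :: b /\ a = u ++ a').
Proof.
elim: u a => [|y u IHu] [|z a] /=.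
- by move=> ->; right; exists [::].
- by move=> ->; right; exists (z :: a).
- by case=> <- <-; left; exists u.
- case=> <- /IHu[[b' [-> ->]]|[a' [-> ->]]].
    by left; exists b'.
  by right; exists a'.
Qed.

Lemma odd_count (T : eqType) (x : T) (s : seq T) :
  odd (count_mem x s) -> x \in s.
Proof. by case: (boolP (x \in s)) => // /count_memPn ->. Qed.

Section SphericalArtin.
Variables (n : nat) (M : 'M[option nat]_n).
Hypothesis hM : is_coxeter_matrix M.
Hypothesis hsph : spherical_type M.
Implicit Types (i j : 'I_n) (u v w p q : seq 'I_n).
Implicit Types (us vs : seq (seq 'I_n)).
Local Notation wprod := (wprod M).
Local Notation refl := (refl M).
Local Notation alt := alternating.
Local Notation G := (artin M).

Definition bond i j := odflt 0%N (M i j).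

Lemma bondC i j : bond i j = bond j i.
Proof. by rewrite /bond Msym. Qed.

(** An infinite entry would give s_i s_j infinite order in the finite group W. So the default 0 in
    [bond] is never met. *)
Lemma bondE i j : i != j -> M i j = Some (bond i j).
Proof.
move=> ij; rewrite /bond; case E: (M i j) => [//|].
have [k k0 hk] := finite_expg (refl i * refl j) hsph.
by have := cox_order hM ij hk; rewrite E; case: k k0 {hk}.
Qed.

Lemma bond_ge2 i j : i != j -> (2 <= bond i j)%N.
Proof. by move=> ij; exact: (Mge2 hM ij (bondE ij)). Qed.

Lemma bond_order i j l : i != j ->
  (refl i * refl j) ^+ l = 1 -> (bond i j %| l)%N.
Proof. by move=> ij /(cox_order hM ij); rewrite bondE. Qed.

Lemma bond_braid i j : i != j ->
  wprod (alternating i j (bond i j)) = wprod (alternating j i (bond i j)).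
Proof. by move=> ij; apply: wprod_braid => //; exact: bondE. Qed.

Lemma bond_expg i j : i != j -> (refl i * refl j) ^+ bond i j = 1.
Proof.
move=> ij; have h : wprod (alternating i j (bond i j + bond i j)) = 1.
  by rewrite alt_double wprod_cat wprod_rev (bond_braid ij) mulgV.
rewrite -h; elim: (bond i j) => [|l IHl]; first by rewrite wprod_nil.
by rewrite addSn addnS !altS !wprod_cons -IHl expgS mulgA.
Qed.

(* The reflections [x_1 .. x_{k-1} x_k x_{k-1} .. x_1] along a word. *)
Fixpoint inversions u : seq (coxeter M) :=
  if u is i :: u' then
    refl i :: [seq refl i * t * (refl i)^-1 | t <- inversions u']
  else [::].

Lemma size_inversions u : size (inversions u) = size u.
Proof. by elim: u => //= i u IHu; rewrite size_map IHu. Qed.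

Lemma inversions_cat u v : inversions (u ++ v) =
  inversions u ++ [seq wprod u * t * (wprod u)^-1 | t <- inversions v].
Proof.
elim: u => [|i u IHu] /=.
  by rewrite wprod_nil -[LHS]map_id; apply: eq_map => t; rewrite invg1 mul1g mulg1.
rewrite IHu map_cat -map_comp wprod_cons; congr (_ :: _ ++ _).
by apply: eq_map => t /=; rewrite invgM !mulgA.
Qed.

Lemma count_conj (x t : coxeter M) (l : seq (coxeter M)) :
  count_mem t [seq x * t' * x^-1 | t' <- l] = count_mem (x^-1 * t * x) l.
Proof.
rewrite count_map; apply: eq_count => t' /=.
by apply/eqP/eqP => [<-|->]; rewrite !mulgA ?mulVg ?mulgV ?mul1g ?mulgVK ?mulgK.
Qed.

Lemma inversions_alt i j l : inversions (alternating i j l) =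
  [seq (refl i * refl j) ^+ k * refl i | k <- iota 0 l].
Proof.
elim: l i j => [//|l IHl] i j.
rewrite altS /= mul1g IHl -[1%N]addn0 iotaDl -!map_comp; congr cons.
apply: eq_map => k /=; rewrite reflV expgS -!mulgA; congr (_ * _).
elim: k => [|k IHk]; first by rewrite !expg0 !mul1g.
by rewrite !expgS -!mulgA IHk.
Qed.

(** Both sides of a braid relation meet the same reflections in opposite orders, because (s_j s_i)^k
    s_j = (s_i s_j)^(m-1-k) s_i. *)
Lemma inversions_braid i j : i != j ->
  inversions (alternating j i (bond i j)) =
  rev (inversions (alternating i j (bond i j))).
Proof.
move=> ij; rewrite !inversions_alt -map_rev.
have m0 : (0 < bond i j)%N := ltnW (bond_ge2 ij).
apply: (@eq_from_nth _ 1); first by rewrite !size_map size_rev.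
move=> k; rewrite size_map size_iota => km.
rewrite (nth_map 0%N) ?size_iota // nth_iota //.
rewrite (nth_map 0%N) ?size_rev ?size_iota //.
rewrite nth_rev ?size_iota // nth_iota ?add0n; last by lia.
have -> : refl j * refl i = (refl i * refl j)^-1 by rewrite invgM !reflV.
set g := refl i * refl j; rewrite expVgn.
apply: (mulgI (g ^+ k)); rewrite mulgA mulgV mul1g mulgA -expgnDr.
have -> : (k + (bond i j - k.+1) = (bond i j).-1)%N by lia.
apply: (mulgI g); rewrite mulgA -expgS prednK // bond_expg // mul1g.
by rewrite /g -mulgA refl_sq mulg1.
Qed.

(** A braid relation permutes the list of reflections and a square adds one reflection twice, so the
    parities depend only on the element of W. *)
Lemma inversions_parity u v : wprod u = wprod v -> forall t,
  odd (count_mem t (inversions u)) = odd (count_mem t (inversions v)).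
Proof.
pose Q u v := wprod u = wprod v /\ forall t,
  odd (count_mem t (inversions u)) = odd (count_mem t (inversions v)).
suff h u' v' : wprod u' = wprod v' -> Q u' v' by move=> /h [].
apply: (@cox_lift n M Q) u' v'; rewrite /Q.
- by [].
- by move=> u' v' [-> h]; split.
- by move=> u' v' w' [-> h] [-> h']; split=> // t; rewrite h.
- move=> p u' v' q [uv h]; split; first by rewrite !wprod_cat uv.
  move=> t; rewrite !inversions_cat !(count_cat, count_conj, map_cat) !oddD.
  by rewrite h uv.
- move=> i j l ij Mij; have {}Mij : bond i j = l by rewrite /bond Mij.
  rewrite -Mij; split; first exact: bond_braid.
  by move=> t; rewrite inversions_braid // count_rev.
- move=> i; split; first by rewrite !wprod_cons wprod_nil mulg1 refl_sq.
  by move=> t /=; rewrite refl_sq mul1g reflV addn0 addnn odd_double.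
Qed.

Lemma inversion_delete u t : t \in inversions u ->
  exists a x b, u = a ++ x :: b /\ t * wprod u = wprod (a ++ b).
Proof.
elim: u t => [//|i u IHu] t /=; rewrite inE => /orP[/eqP->|/mapP[t' /IHu]].
  by exists [::], i, u; rewrite wprod_cons mulgA refl_sq mul1g.
move=> [a [x [b [-> h]]]] ->; exists (i :: a), x, b; split=> //.
by rewrite wprod_cons mulgA mulgVK -mulgA h -wprod_cons.
Qed.

Definition red u := forall v, wprod v = wprod u -> (size u <= size v)%N.

Lemma red_ex u : exists2 v, wprod v = wprod u & red v.
Proof.
have [k] := ubnP (size u); elim: k u => // k IHk u uk.
have [|] := pselect (red u); first by exists u.
move=> /existsNP[v /not_implyP[vu /negP]]; rewrite -ltnNge => lt.
by have [|w wv rw] := IHk v; [lia|exists w => //; rewrite wv].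
Qed.

Lemma red_eq u v : red u -> wprod v = wprod u -> (size v <= size u)%N -> red v.
Proof. by move=> ru vu le w wv; rewrite (leq_trans le) // ru // wv. Qed.

Lemma red_size u v : red u -> red v -> wprod u = wprod v -> size u = size v.
Proof. by move=> ru rv e; apply/eqP; rewrite eqn_leq ru ?rv. Qed.

Lemma red_infix a u b : red (a ++ u ++ b) -> red u.
Proof.
move=> h v vu; have := h (a ++ v ++ b).
by rewrite !wprod_cat vu !size_cat leq_add2l leq_add2r => /(_ erefl).
Qed.

Lemma red_catl a u : red (a ++ u) -> red a.
Proof. exact: (@red_infix [::]). Qed.

Lemma red_catr a u : red (a ++ u) -> red u.
Proof. by rewrite -[u in red (a ++ u)]cats0 => /red_infix. Qed.

Lemma red_behead x u : red (x :: u) -> red u.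
Proof. exact: (@red_catr [:: x]). Qed.

Lemma red_rev u : red u -> red (rev u).
Proof.
move=> ru v; rewrite wprod_rev size_rev -(size_rev v) => vu.
by apply: ru; rewrite wprod_rev vu invgK.
Qed.

Lemma red_nil : red [::]. Proof. by []. Qed.

Lemma nred_double x u : ~ red (x :: x :: u).
Proof.
move=> /(_ u); rewrite !wprod_cons mulgA refl_sq mul1g => /(_ erefl) /=; lia.
Qed.

(** Distinct reflections have multiplicity one, hence odd multiplicity along every word of the same
    element, which therefore has at least as many letters. *)
Lemma red_uniq_inversions u : uniq (inversions u) -> red u.
Proof.
move=> uu v vu; rewrite -!size_inversions; apply: (uniq_leq_size uu) => t tu.
by apply: odd_count; rewrite (inversions_parity vu) count_uniq_mem // tu.
Qed.

(** If s_x were not among the reflections of [u], it would have odd multiplicity along [x :: u],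
    hence occur along a shorter word [v] of the same element; deleting a letter of [v] would then
    give a word for [u] that is too short. *)
Lemma exchange x u : red u -> ~ red (x :: u) ->
  exists a y b, u = a ++ y :: b /\ refl x * wprod u = wprod (a ++ b).
Proof.
move=> ru nr; apply: inversion_delete; apply: contrapT => /negP xu.
case: nr => v vxu; rewrite leqNgt; apply/negP => lt.
have : refl x \in inversions v.
  apply: odd_count; rewrite (inversions_parity vxu) /= eqxx count_conj.
  by rewrite mulVg mul1g; move/count_memPn: xu => ->.
move=> /inversion_delete[a [y [b [ev]]]].
rewrite vxu wprod_cons mulgA refl_sq mul1g => h.
by have := ru _ (esym h); move: lt; rewrite ev !size_cat /=; lia.
Qed.

Lemma red_alt i j l : i != j -> (l <= bond i j)%N -> red (alternating i j l).
Proof.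
move=> ij lm; apply: red_uniq_inversions; rewrite inversions_alt.
rewrite map_inj_in_uniq ?iota_uniq // => a b; rewrite !mem_iota /= add0n.
suff lt a' b' : (a' < b' < l)%N ->
    (refl i * refl j) ^+ a' <> (refl i * refl j) ^+ b'.
  move=> al bl /mulIg e; case: (ltngtP a b) => // h.
    by case: (lt a b) => //; rewrite h.
  by case: (lt b a) => //; rewrite h.
move=> /andP[ab bl] e; have := @bond_order i j (b' - a') ij.
rewrite expgnFr ?(ltnW ab) // e mulgV => /(_ erefl) /dvdn_leq; lia.
Qed.

(** * Cosets of dihedral subgroups *)

Definition dihedral i j u := all (mem [:: i; j]) u.

Lemma dihedral_cat i j u v :
  dihedral i j (u ++ v) = dihedral i j u && dihedral i j v.
Proof. exact: all_cat. Qed.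

Lemma dihedral_rev i j u : dihedral i j (rev u) = dihedral i j u.
Proof. exact: all_rev. Qed.

Lemma dihedral_alt i j l :
  dihedral i j (alternating i j l) /\ dihedral i j (alternating j i l).
Proof.
by split; apply/allP => x /alt_letters; rewrite !inE => -[] ->; rewrite eqxx ?orbT.
Qed.

Lemma dihedral_normal i j d : i != j -> dihedral i j d ->
  exists2 l, (l <= bond i j)%N &
    wprod d = wprod (alternating i j l) \/ wprod d = wprod (alternating j i l).
Proof.
move=> ij; elim: d => [|x d IHd] /=; first by exists 0%N; [|left].
case/andP; rewrite !inE => xij /IHd[l lm hl].
wlog -> : i j ij xij lm hl {IHd} / x = i.
  move=> W; case/orP: xij => /eqP xe; first by apply: W => //; rewrite xe eqxx.
  have [||||k km hk] := W j i _ _ _ _ xe; first by rewrite eq_sym.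
  - by rewrite xe eqxx.
  - by rewrite bondC.
  - by case: hl; [right|left].
  by exists k; [rewrite bondC|case: hk; [right|left]].
have step k : (k <= bond i j)%N -> wprod d = wprod (alternating i j k) ->
  exists2 l, (l <= bond i j)%N & wprod (i :: d) = wprod (alternating i j l) \/
    wprod (i :: d) = wprod (alternating j i l).
  case: k => [_ hd|k km hd].
    exists 1%N; first exact: ltnW (bond_ge2 ij).
    by left; rewrite !wprod_cons hd.
  exists k; first exact: ltnW; right.
  by rewrite wprod_cons hd altS wprod_cons mulgA refl_sq mul1g.
case: hl => hl; first exact: step hl.
case: (ltnP l (bond i j)) => [lt|ge].
  by exists l.+1 => //; left; rewrite altS !wprod_cons hl.
have e : l = bond i j by lia.
by apply: (step l) => //; rewrite hl e bond_braid.
Qed.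

(** [c'] is a shortest element in the coset of [c] under the subgroup generated by s_i and s_j. If
    reducedness failed, the exchange condition would delete a letter either of the alternating word,
    contradicting [red_alt], or of [c'], contradicting its minimality. *)
Lemma dihedral_coset i j c : i != j -> exists d c',
  [/\ dihedral i j d, wprod c = wprod (d ++ c')
    & forall l, (l <= bond i j)%N ->
      red (alternating i j l ++ c') /\ red (alternating j i l ++ c')].
Proof.
move=> ij; pose P k := `[< exists d c', [/\ dihedral i j d,
  wprod c = wprod (d ++ c') & size c' = k] >].
have exP : exists k, P k by exists (size c); apply/asboolP; exists [::], c.
case: (ex_minnP exP) => k /asboolP[d [c' [dd cd <-]]] kmin.
exists d, c'; split=> //.
have cmin e c'' : dihedral i j e -> wprod c' = wprod (e ++ c'') ->
    (size c' <= size c'')%N.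
  move=> de ce; apply: kmin; apply/asboolP; exists (d ++ e), c''; split=> //.
    by rewrite dihedral_cat dd.
  by rewrite cd -catA !wprod_cat ce wprod_cat.
suff main l x y : (l <= bond i j)%N -> (x = i /\ y = j) \/ (x = j /\ y = i) ->
    red (alternating x y l ++ c').
  by move=> l lm; split; apply: main => //; auto.
elim: l x y => [|l IHl] x y lm xy.
  by move=> c'' e; apply: (cmin [::]).
have dx h : dihedral i j (alternating x y h).
  by case: xy => -[-> ->]; case: (dihedral_alt i j h).
have dy h : dihedral i j (alternating y x h).
  by case: xy => -[-> ->]; case: (dihedral_alt i j h).
have {IHl} rl : red (alternating y x l ++ c').
  by apply: IHl; [lia|case: xy => -[-> ->]; auto].
apply: contrapT; rewrite altS cat_cons => /(exchange rl) [a [z [b [e he]]]].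
rewrite wprod_cat mulgA -wprod_cons -altS in he.
case: (cat_delete e) => [[b' [e1 e2]]|[a' [e1 e2]]].
  have rx : red (alternating x y l.+1).
    by case: xy => -[-> ->]; apply: red_alt; rewrite // ?(eq_sym j) ?(bondC j).
  have := rx (a ++ b'); rewrite wprod_cat.
  have -> : wprod a * wprod b' = wprod (alternating x y l.+1).
    by apply: (mulIg (wprod c')); rewrite he e2 !wprod_cat mulgA.
  rewrite altS /= e1 !size_cat /= => /(_ erefl); lia.
have := cmin (rev (alternating x y l.+1) ++ alternating y x l) (a' ++ b).
have -> : dihedral i j (rev (alternating x y l.+1) ++ alternating y x l).
  by rewrite dihedral_cat dihedral_rev dx dy.
move=> /(_ isT); rewrite -catA wprod_cat catA -e2 -he wprod_rev mulKg => /(_ erefl).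
by rewrite {1}e1 !size_cat /=; lia.
Qed.

(** Write [c] as an alternating word of length l followed by a minimal [c']. If l < m, that word
    could be prolonged on the left by i or by j, and this letter would not be a descent. *)
Lemma two_descents i j c : i != j -> red c ->
  ~ red (i :: c) -> ~ red (j :: c) ->
  exists2 c', red (alternating i j (bond i j) ++ c') &
    wprod c = wprod (alternating i j (bond i j) ++ c').
Proof.
move=> ij rc ni nj; have [d [c' [dd cd hl]]] := dihedral_coset c ij.
have [l lm ld] := dihedral_normal ij dd; have [r1 r2] := hl l lm.
exists c'; first by have [] := hl _ (leqnn (bond i j)).
case: (ltnP l (bond i j)) => [lt|ge].
  have W x y : wprod d = wprod (alternating y x l) ->
      red (alternating x y l.+1 ++ c') -> red (x :: c).
    move=> dl r; apply: (red_eq r).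
      by rewrite altS cat_cons !wprod_cons cd !wprod_cat dl.
    by rewrite altS /= ltnS; apply: rc; rewrite cd !wprod_cat dl.
  have [r1' r2'] := hl l.+1 lt; case: ld => ld.
    by case: nj; exact: W ld r2'.
  by case: ni; exact: W ld r1'.
have e : l = bond i j by lia.
by rewrite cd !wprod_cat; case: ld => ->; rewrite e // bond_braid.
Qed.

(** The dihedral part of [c] is trivial here: a non-empty alternating prefix would start with i or
    j, which would then be a left descent. *)
Lemma two_ascents i j c l : i != j -> red (i :: c) -> red (j :: c) ->
  (l <= bond i j)%N -> red (alternating i j l ++ c).
Proof.
move=> ij ri rj lm; have rc := red_behead ri.
have [d [c' [dd cd hl]]] := dihedral_coset c ij.
have [k km kd] := dihedral_normal ij dd; have [r1 r2] := hl k km.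
have [r _] := hl l lm.
have W x y : x \in [:: i; j] -> wprod d = wprod (alternating x y k) ->
    red (alternating x y k ++ c') -> wprod c = wprod c'.
  move=> xij dk rk; case: k {km kd hl r1 r2} dk rk => [|k] dk rk.
    by rewrite cd wprod_cat dk [X in X * _]wprod_nil mul1g.
  have rx : red (x :: c) by move: xij; rewrite !inE => /orP[] /eqP ->.
  have sz := red_size rc rk; rewrite cd !wprod_cat dk in sz.
  have /= := rx (alternating y x k ++ c').
  rewrite wprod_cons cd !wprod_cat dk altS wprod_cons !mulgA refl_sq mul1g.
  by move=> /(_ erefl); rewrite sz // altS /=; lia.
have e : wprod c = wprod c'.
  by case: kd => kd; apply: W kd _ => //; rewrite !inE eqxx ?orbT.
apply: (red_eq r); first by rewrite !wprod_cat e.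
by rewrite !size_cat leq_add2l rc.
Qed.

(** * The braid monoid *)

(** The braid monoid as a congruence on positive words; [cl_beq] later identifies it with equality
    in the Artin-Tits group. *)
Inductive beq : seq 'I_n -> seq 'I_n -> Prop :=
| beq_refl u : beq u u
| beq_sym u v : beq u v -> beq v u
| beq_trans v u w : beq u v -> beq v w -> beq u w
| beq_braid p q i j : i != j ->
    beq (p ++ alt i j (bond i j) ++ q) (p ++ alt j i (bond i j) ++ q).

Local Notation "u ~ v" := (beq u v) (at level 70).

#[local] Hint Resolve beq_refl : core.

#[local] Instance beq_equiv : RelationClasses.Equivalence beq.
Proof.
split; [exact: beq_refl|exact: beq_sym|move=> u v w; exact: beq_trans].
Qed.

Lemma beq_catl p u v : u ~ v -> p ++ u ~ p ++ v.
Proof.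
elim=> {u v} [u|u v _|v u w _ uv _|r q i j ij].
- exact: beq_refl.
- exact: beq_sym.
- exact: beq_trans.
- by rewrite !(catA p); exact: beq_braid.
Qed.

Lemma beq_catr p u v : u ~ v -> u ++ p ~ v ++ p.
Proof.
elim=> {u v} [u|u v _|v u w _ uv _|r q i j ij].
- exact: beq_refl.
- exact: beq_sym.
- exact: beq_trans.
- by rewrite -!catA; exact: beq_braid.
Qed.

#[local] Instance cat_beq : Morphisms.Proper
  (Morphisms.respectful beq (Morphisms.respectful beq beq)) cat.
Proof.
by move=> u v uv p q pq; apply: beq_trans (beq_catr _ uv) (beq_catl _ pq).
Qed.

#[local] Instance cons_beq : Morphisms.Proper
  (Morphisms.respectful eq (Morphisms.respectful beq beq)) cons.
Proof. by move=> i _ <- p q pq; apply: (beq_catl [:: i]). Qed.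

Lemma beq_size u v : u ~ v -> size u = size v.
Proof.
elim=> {u v} [u|u v _|v u w _ -> _|r q i j ij] //.
by rewrite !size_cat !size_alt.
Qed.

Definition ldvd p u := exists r, u ~ p ++ r.

Lemma ldvd_cat p r : ldvd p (p ++ r). Proof. by exists r. Qed.

Lemma ldvd_refl p : ldvd p p. Proof. by exists [::]; rewrite cats0. Qed.

Lemma ldvd_nil p : ldvd [::] p. Proof. by exists p. Qed.

Lemma ldvd_trans q p u : ldvd p q -> ldvd q u -> ldvd p u.
Proof. by case=> r qr [s us]; exists (r ++ s); rewrite us qr catA. Qed.

Lemma ldvd_catl p u v : ldvd u v -> ldvd (p ++ u) (p ++ v).
Proof. by case=> r h; exists r; rewrite h catA. Qed.

Lemma ldvd_cons x u v : ldvd u v -> ldvd (x :: u) (x :: v).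
Proof. exact: (@ldvd_catl [:: x]). Qed.

#[local] Instance ldvd_proper : Morphisms.Proper
  (Morphisms.respectful beq (Morphisms.respectful beq iff)) ldvd.
Proof.
move=> u v uv p q pq; split=> -[r h].
  by exists r; rewrite -pq -uv.
by exists r; rewrite pq uv.
Qed.

Lemma beq_alt i j : i != j -> alt i j (bond i j) ~ alt j i (bond i j).
Proof. by move=> ij; have := beq_braid [::] [::] ij; rewrite !cats0. Qed.

Lemma bond_predn i j : i != j -> bond i j = (bond i j).-1.+1.
Proof. by move=> ij; have := bond_ge2 ij; lia. Qed.

Lemma altm i j : i != j -> alt i j (bond i j) = i :: alt j i (bond i j).-1.
Proof. by move=> ij; rewrite (bond_predn ij) altS. Qed.

Lemma altmC i j : i != j -> alt j i (bond i j) = j :: alt i j (bond i j).-1.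
Proof. by move=> ij; rewrite {1}(bond_predn ij) altS. Qed.

Lemma beq_altm i j : i != j ->
  i :: alt j i (bond i j).-1 ~ j :: alt i j (bond i j).-1.
Proof.
by move=> ij; rewrite -altm // (beq_alt ij) altmC.
Qed.

Lemma beq_wprod u v : u ~ v -> wprod u = wprod v.
Proof.
elim=> {u v} [u|u v _|v u w _ -> _|r q i j ij] //.
by rewrite !wprod_cat bond_braid.
Qed.

Lemma beq_red u v : u ~ v -> red u -> red v.
Proof.
move=> uv ru; apply: (red_eq ru); first by rewrite (beq_wprod uv).
by rewrite (beq_size uv).
Qed.

#[local] Instance red_proper : Morphisms.Proper
  (Morphisms.respectful beq iff) red.
Proof. by move=> u v uv; split; apply: beq_red; rewrite ?uv. Qed.

Lemma beq_rev u v : u ~ v -> rev u ~ rev v.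
Proof.
elim=> {u v} [u|u v _|v u w _ uv _|r q i j ij].
- exact: beq_refl.
- exact: beq_sym.
- exact: beq_trans.
- rewrite !rev_cat !rev_alt -!catA.
  by case: odd; [exact: beq_braid|symmetry; exact: beq_braid].
Qed.

Lemma red_alt_cat i j u : i != j -> red (rcons u i) -> red (rcons u j) ->
  red (u ++ alt i j (bond i j)).
Proof.
move=> ij /red_rev + /red_rev; rewrite !rev_rcons => ri rj.
rewrite -[_ ++ _]revK rev_cat rev_alt; apply: red_rev.
case: (odd _); first exact: two_ascents.
by rewrite bondC //; apply: two_ascents; rewrite // eq_sym.
Qed.

(** When the first letters i and j differ, both are left descents, so the element starts with the
    full alternating words on i and j. By induction each word equals the one with its own first
    letter, and a braid relation joins these two. *)
Lemma matsumoto u v : red u -> red v -> wprod u = wprod v -> u ~ v.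
Proof.
have [k] := ubnP (size u); elim: k u v => // k IHk u v uk ru rv uv.
have := red_size ru rv uv; case: u v ru rv uv uk => [|i u] [|j v] //.
move=> ru rv uv /= uk [sz].
case: (eqVneq i j) => [e|ij].
  rewrite -e in rv uv *; rewrite (IHk u v) //; first exact: red_behead ru.
    exact: red_behead rv.
  by apply: (mulgI (refl i)); rewrite -!wprod_cons.
have [||c' rc' e] := two_descents ij ru; first exact: nred_double.
  move=> /(_ v); rewrite wprod_cons uv wprod_cons mulgA refl_sq mul1g.
  by move=> /(_ erefl) /=; lia.
have sc := red_size ru rc' e.
have re := rc'; rewrite (beq_alt ij) in re.
have ev : wprod (j :: v) = wprod (alt j i (bond i j) ++ c').
  by rewrite -uv e !wprod_cat bond_braid.
rewrite altm // in rc' e sc.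
rewrite altmC // in re ev.
have h1 : u ~ alt j i (bond i j).-1 ++ c'.
  apply: IHk => //; [exact: red_behead ru|exact: red_behead rc'|].
  by apply: (mulgI (refl i)); rewrite -!wprod_cons.
have h2 : v ~ alt i j (bond i j).-1 ++ c'.
  apply: IHk => //; [lia|exact: red_behead rv|exact: red_behead re|].
  by apply: (mulgI (refl j)); rewrite -!wprod_cons.
by rewrite h1 h2 -!cat_cons beq_altm.
Qed.

(** For equal first letters this is left cancellation; for distinct ones it says that both words
    equal the lcm of the two letters followed by a common [w]. *)
Definition head_spec u v : Prop :=
  match u, v with
  | [::], [::] => True
  | i :: u', j :: v' =>
      if i == j then u' ~ v'
      else exists w, u' ~ alt j i (bond i j).-1 ++ w /\
                     v' ~ alt i j (bond i j).-1 ++ w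
  | _, _ => False
  end.

(* [T] bounds the lengths for which the description [head_spec] of equal words
   is already known: it is needed below some length in the inductive proof of
   [beq_head], and for all lengths afterwards. *)
Section LocalLcm.
Variable T : nat -> Prop.
Hypothesis Tle : forall a b, (a <= b)%N -> T b -> T a.
Hypothesis head : forall u v, T (size u) -> u ~ v -> head_spec u v.

Lemma local_cancel p u v : T (size (p ++ u)) -> p ++ u ~ p ++ v -> u ~ v.
Proof.
elim: p => [//|i p IHp] /= Tu uv; apply: IHp; first exact: Tle Tu.
by have /= := head (u := i :: p ++ u) Tu uv; rewrite eqxx.
Qed.

Lemma local_ldvd_cons i p u v : T (size u) -> u ~ i :: v -> ldvd (i :: p) u ->
  ldvd p v.
Proof.
move=> Tu uv [r ur]; exists r; apply: (@local_cancel [:: i]) => /=.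
  by rewrite -[_.+1]/(size (i :: v)) -(beq_size uv).
by rewrite -uv ur.
Qed.

Lemma local_ldvd_two i j u v : i != j -> T (size u) -> u ~ i :: v ->
  ldvd [:: j] u -> ldvd (alt j i (bond i j).-1) v.
Proof.
move=> ij Tu uv [r ur].
have Tv : T (size (i :: v)) by rewrite -(beq_size uv).
have := head Tv (beq_trans (beq_sym uv) ur).
by rewrite /= (negbTE ij) => -[w [h _]]; exists w.
Qed.

Lemma ldvd_head i p u : ldvd (i :: p) u -> exists v, u ~ i :: v.
Proof. by case=> r h; exists (p ++ r). Qed.

Lemma ldvd_head1 i p u : ldvd (i :: p) u -> ldvd [:: i] u.
Proof. by case=> r h; exists (p ++ r). Qed.

(** When the first letters i and j differ, the lcm of [i :: p] with the lcm of i and j is taken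
    first, then the lcm of the result with [j :: q]; each step cancels one letter and so works below
    a shorter [y]. The last clause serves to show that the lcm of three letters is reduced. *)
Lemma local_lcm (y : seq 'I_n) p q : T (size y) -> ldvd p y -> ldvd q y -> exists l,
  [/\ ldvd p l, ldvd q l, ldvd l y,
    forall y' : seq 'I_n, T (size y') -> ldvd p y' -> ldvd q y' -> ldvd l y'
  & forall c, red (c ++ p) -> red (c ++ q) -> red (c ++ l)].
Proof.
have [k] := ubnP (size y); elim: k y p q => // k IHk y [|i p] [|j q] yk Ty py qy.
- by exists [::]; split=> //; exact: ldvd_nil.
- by exists (j :: q); split=> //; [exact: ldvd_nil|exact: ldvd_refl].
- by exists (i :: p); split=> //; [exact: ldvd_refl|exact: ldvd_nil].
have [u yu] := ldvd_head py; have sy := beq_size yu.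
have Tu : T (size u) by apply: Tle Ty; rewrite sy /=.
have uk : (size u < k)%N by move: yk; rewrite sy /=; lia.
case: (eqVneq i j) => [ej|ij].
  rewrite -{}ej in qy *.
  have [l [pl ql lu univ rl]] :=
    IHk u p q uk Tu (local_ldvd_cons Ty yu py) (local_ldvd_cons Ty yu qy).
  exists (i :: l); split; [exact: ldvd_cons|exact: ldvd_cons| | |].
  - by rewrite yu; exact: ldvd_cons.
  - move=> y' Ty' py' qy'; have [u' yu'] := ldvd_head py'.
    rewrite yu'; apply/ldvd_cons/univ; last exact: (local_ldvd_cons Ty' yu' qy').
      by apply: Tle Ty'; rewrite (beq_size yu') /=.
    exact: (local_ldvd_cons Ty' yu' py').
  - by move=> c; rewrite -!cat_rcons; exact: rl.
have ji : j != i by rewrite eq_sym.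
have [l1 [pl1 al1 l1u univ1 rl1]] := IHk u p (alt j i (bond i j).-1) uk Tu
  (local_ldvd_cons Ty yu py) (local_ldvd_two ij Ty yu (ldvd_head1 qy)).
case: (al1) => g1 l1g; set w := alt i j (bond i j).-1 ++ g1.
have ilw : i :: l1 ~ j :: w by rewrite l1g -!cat_cons beq_altm.
have [v yv] := ldvd_head qy; have sv := beq_size yv.
have wy : ldvd (j :: w) y by rewrite -ilw yu; exact: ldvd_cons.
have [||||l2 [wl2 ql2 l2v univ2 rl2]] := IHk v w q.
- by move: yk; rewrite sv /=; lia.
- by apply: Tle Ty; rewrite sv /=.
- exact: (local_ldvd_cons Ty yv wy).
- exact: (local_ldvd_cons Ty yv qy).
exists (j :: l2); split.
- apply: ldvd_trans (ldvd_cons j wl2); rewrite -ilw; exact: ldvd_cons.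
- exact: ldvd_cons.
- by rewrite yv; exact: ldvd_cons.
- move=> y' Ty' py' qy'; have [u' yu'] := ldvd_head py'.
  have [v' yv'] := ldvd_head qy'.
  have l1u' : ldvd l1 u'.
    apply: univ1; first by apply: Tle Ty'; rewrite (beq_size yu') /=.
      exact: (local_ldvd_cons Ty' yu' py').
    exact: local_ldvd_two ij Ty' yu' (ldvd_head1 qy').
  rewrite yv'; apply/ldvd_cons/univ2; last exact: (local_ldvd_cons Ty' yv' qy').
    by apply: Tle Ty'; rewrite (beq_size yv') /=.
  by apply: (local_ldvd_cons Ty' yv'); rewrite -ilw yu'; exact: ldvd_cons.
- move=> c rp rq; rewrite -cat_rcons; apply: rl2; last by rewrite cat_rcons.
  rewrite cat_rcons -ilw -cat_rcons; apply: rl1; rewrite cat_rcons //.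
  rewrite -altm //; apply: red_alt_cat => //.
    by move: rp; rewrite -cat_rcons => /red_catl.
  by move: rq; rewrite -cat_rcons => /red_catl.
Qed.

End LocalLcm.

(** Both letters are left descents of a reduced word, so the claim holds in W by [two_descents], and
    Matsumoto's theorem lifts it to the monoid. *)
Lemma red_head i j u v : i != j -> red (i :: u) -> i :: u ~ j :: v ->
  exists w, u ~ alt j i (bond i j).-1 ++ w /\ v ~ alt i j (bond i j).-1 ++ w.
Proof.
move=> ij ru uv; have rv := beq_red uv ru.
have [||c' rc' e] := two_descents ij ru; first exact: nred_double.
  by rewrite uv; exact: nred_double.
have re := rc'; rewrite (beq_alt ij) in re.
have ev : wprod (j :: v) = wprod (alt j i (bond i j) ++ c').
  by rewrite -(beq_wprod uv) e !wprod_cat bond_braid.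
rewrite altm // in rc' e; rewrite altmC // in re ev.
exists c'; split; apply: matsumoto.
- exact: red_behead ru.
- exact: red_behead rc'.
- by apply: (mulgI (refl i)); rewrite -!wprod_cons.
- exact: red_behead rv.
- exact: red_behead re.
- by apply: (mulgI (refl j)); rewrite -!wprod_cons.
Qed.

(* Equal words with first letters i and j are divisible by the lcm of i and j.
   [head_spec] holds for one braid relation, so only its transitivity matters;
   for three distinct first letters the lcm of the three letters is reduced, and
   the claim reduces to the Coxeter group. *)
Lemma beq_head u v : u ~ v -> head_spec u v.
Proof.
have [k] := ubnP (size u); elim: k u v => // k IHk u v + uv.
have IH u' v' : (size u' < k)%N -> u' ~ v' -> head_spec u' v'.
  by move=> *; exact: IHk.
have Tle a b : (a <= b)%N -> (b < k)%N -> (a < k)%N by lia.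
pose canc := @local_cancel (fun a => (a < k)%N) Tle IH.
elim: uv => {u v} [u|u v uv IHuv|v u w uv IHuv vw IHvw|r q i j ij] uk.
- by case: u {uk} => //= i u; rewrite eqxx.
- move: IHuv; rewrite (beq_size uv) => /(_ uk).
  case: u v {uv uk} => [|i u] [|j v] //=.
  rewrite eq_sym; case: eqVneq => [_|ij]; first exact: beq_sym.
  by case=> w [h1 h2]; exists w; rewrite bondC.
- move: (IHuv uk) IHvw; rewrite -(beq_size uv) => + /(_ uk).
  case: u v w uv vw uk {IHuv} => [|i u] [|j v] [|l w] //= uv vw uk.
  have szu := beq_size uv; have szw := beq_size vw.
  case: (eqVneq i j) => [<-|ij].
    case: eqVneq => [_|il]; first by move=> -> .
    by move=> h [x [h1 h2]]; exists x; rewrite h.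
  case=> x [h1 h2]; case: (eqVneq j l) => [<-|jl].
    by rewrite (negbTE ij) => h; exists x; rewrite -h.
  case=> y [h3 h4]; case: (eqVneq i l) => [il|il].
    rewrite -il in h3 h4 jl *; rewrite (bondC j i) in h3 h4.
    have xy : x ~ y.
      apply: (canc (alt i j (bond i j).-1)); last by rewrite -h2.
      by rewrite -(beq_size h2); move: szu uk => /=; lia.
    by rewrite h1 h4 xy.
  have vk : (size v < k)%N by move: szu uk => /=; lia.
  have ji : j != i by rewrite eq_sym.
  have lj : l != j by rewrite eq_sym.
  have ci : ldvd (alt i j (bond i j).-1) v by exists x.
  have cl : ldvd (alt l j (bond j l).-1) v by exists y.
  (* [v] is a common multiple of what remains, after j, of the lcm of j with i and of the lcm of j
     with l. So these remainders have an lcm [l0], and [j :: l0] is the lcm of the three letters. *)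
  have [l0 [[f l0f] [g l0g] [z vz] _ rl0]] := local_lcm Tle IH vk ci cl.
  have {}rl0 : red (j :: l0).
    apply: (rl0 [:: j]); rewrite /= -?altmC -?altm //; apply: red_alt => //.
    by rewrite bondC.
  have e1 : j :: l0 ~ i :: alt j i (bond i j).-1 ++ f.
    by rewrite l0f -!cat_cons beq_altm.
  have e2 : j :: l0 ~ l :: alt j l (bond j l).-1 ++ g.
    by rewrite l0g -!cat_cons beq_altm.
  have [t [h5 h6]] : exists t,
      alt j i (bond i j).-1 ++ f ~ alt l i (bond i l).-1 ++ t /\
      alt j l (bond j l).-1 ++ g ~ alt i l (bond i l).-1 ++ t.
    by apply: red_head => //; rewrite -?e1 // -e2.
  have xz : x ~ f ++ z.
    apply: (canc (alt i j (bond i j).-1)); first by rewrite -(beq_size h2).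
    by rewrite -h2 vz l0f catA.
  have yz : y ~ g ++ z.
    apply: (canc (alt l j (bond j l).-1)); first by rewrite -(beq_size h3).
    by rewrite -h3 vz l0g catA.
  exists (t ++ z).
  by rewrite h1 h4 xz yz catA h5 -catA [_ ++ (g ++ z)]catA h6 -catA.
- case: r uk => [|x r] /= uk; last by rewrite eqxx; exact: beq_braid.
  rewrite altm // altmC //= (negbTE ij).
  by exists q.
Qed.

Lemma ldvd_lcm (y : seq 'I_n) p q : ldvd p y -> ldvd q y -> exists l,
  [/\ ldvd p l, ldvd q l, ldvd l y
  & forall y' : seq 'I_n, ldvd p y' -> ldvd q y' -> ldvd l y'].
Proof.
move=> py qy; have h u v (_ : True) := @beq_head u v.
have [l [pl ql ly univ _]] :=
  @local_lcm (fun=> True) (fun _ _ _ _ => I) h y p q I py qy.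
by exists l; split=> // y'; exact: univ.
Qed.

Lemma beq_cancel p u v : p ++ u ~ p ++ v -> u ~ v.
Proof.
elim: p => [//|i p IHp] /beq_head /=; rewrite eqxx; exact: IHp.
Qed.

Lemma beq_cancel1 i u v : i :: u ~ i :: v -> u ~ v.
Proof. exact: (@beq_cancel [:: i]). Qed.

Lemma beq_cancelr p u v : u ++ p ~ v ++ p -> u ~ v.
Proof.
move=> /beq_rev; rewrite !rev_cat => /beq_cancel /beq_rev.
by rewrite !revK.
Qed.

(** * The Garside element *)

Lemma red_bounded : exists N, forall u, red u -> (size u <= N)%N.
Proof.
have ex (z : coxeter M) : exists u, red u /\ wprod u = z.
  by have [u ->] := wprod_surj z; have [v <- rv] := red_ex u; exists v.
have [N hN] := finite_set_bound (fun z => size (sval (cid (ex z)))) hsph.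
exists N => u ru; apply: leq_trans (hN (wprod u)).
by case: cid => v /= [rv vu]; exact: ru.
Qed.

(** With all letters this gives a word for Delta, with a proper subset I a word for w_I. Finiteness
    of W bounds the lengths of reduced words, so a longest one exists. *)
Lemma longest_red (I : {pred 'I_n}) : exists u,
  [/\ red u, {subset u <= I}, forall i, i \in I -> ~ red (i :: u)
    & forall i, i \in I -> ~ red (rcons u i)].
Proof.
have [N hN] := red_bounded.
pose P k := `[< exists u, [/\ red u, {subset u <= I} & size u = k] >].
have exP : exists k, P k.
  by exists 0%N; apply/asboolP; exists [::]; split=> //; exact: red_nil.
have ubP k : P k -> (k <= N)%N by move=> /asboolP[u [/hN + _ <-]].
case: (ex_maxnP exP ubP) => k /asboolP[u [ru uI <-]] kmax.
exists u; split=> // i iI ri.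
  suff : P (size u).+1 by move=> /kmax; rewrite ltnn.
  apply/asboolP; exists (i :: u); split=> // j; rewrite inE.
  by case/orP => [/eqP -> //|/uI].
suff : P (size u).+1 by move=> /kmax; rewrite ltnn.
apply/asboolP; exists (rcons u i); rewrite size_rcons; split=> // j.
by rewrite mem_rcons inE; case/orP => [/eqP -> //|/uI].
Qed.

(* Reading v from right to left, the exchange condition moves its letters one
   by one to the front of a reduced word of the longest element. *)
Lemma red_ldvd_longest d v : red d -> (forall i, ~ red (i :: d)) -> red v ->
  ldvd v d.
Proof.
move=> rd nd; elim: v => [|x v IHv] rv; first exact: ldvd_nil.
have [y dy] := IHv (red_behead rv).
have rvy := beq_red dy rd.
have : ~ red (x :: v ++ y) by move=> r; apply: (nd x); rewrite dy.
move=> /(exchange rvy)[a [z [b [e h]]]].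
case: (cat_delete e) => -[c [e1 e2]].
  have /= := rv (a ++ c); rewrite e1 size_cat [X in (_ < X)%N]size_cat /=.
  suff -> : wprod (a ++ c) = wprod (x :: a ++ z :: c).
    by move=> /(_ erefl); lia.
  apply: (mulIg (wprod y)); rewrite -wprod_cat -catA -e2 -h -e1.
  by rewrite wprod_cons wprod_cat mulgA.
have e3 : wprod (x :: v ++ c ++ b) = wprod d.
  rewrite (beq_wprod dy) wprod_cons catA -e2 -h mulgA refl_sq mul1g.
  by [].
exists (c ++ b); symmetry; apply: (matsumoto) => //.
apply: (red_eq rd e3); rewrite (beq_size dy) e1 /= !size_cat /=; lia.
Qed.

(** * Conjugation by the longest element *)

Variable d : seq 'I_n.
Hypotheses (rd : red d) (nd : forall i, ~ red (i :: d)).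

Lemma redP u : red u <-> ldvd u d.
Proof.
split; first exact: red_ldvd_longest.
by case=> y dy; apply: (@red_catl _ y); exact: beq_red dy rd.
Qed.

Lemma beq_rev_longest : rev d ~ d.
Proof.
have /redP[y dy] := red_rev rd.
have := beq_size dy; rewrite size_cat size_rev.
case: y dy => [|x y] dy /=; last by lia.
by rewrite cats0 in dy; rewrite -dy.
Qed.

Lemma red1 i : red [:: i].
Proof.
case: hM => n2 _ _ _ _; pose j := if i == Ordinal (ltnW n2) then Ordinal n2
  else Ordinal (ltnW n2).
have ij : i != j by rewrite /j; case: (eqVneq i (Ordinal (ltnW n2))) => [->|].
by apply: (red_alt (l := 1) ij); exact: ltnW (bond_ge2 ij).
Qed.

Lemma beq1 i j : [:: i] ~ [:: j] -> i = j.
Proof.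
move=> /(beq_head) /=; case: eqVneq => // ij.
case=> w [/beq_size + _]; rewrite size_cat size_alt /=.
by have := bond_ge2 ij; lia.
Qed.

(** Write d = x y. As [y] is reduced it divides [d] too, and d = y t for a single letter t by
    comparing lengths, so x d = x y t = d t. *)
Lemma conj_longest_ex x : exists t, x :: d ~ rcons d t.
Proof.
have /redP[y dy] := @red1 x.
have ry : red y by apply: (@red_catr [:: x]); exact: beq_red dy rd.
have /redP[[|t [|t' z]] dz] := ry.
- by have := beq_size dy; have := beq_size dz; rewrite !size_cat /=; lia.
- by exists t; rewrite {1}dz -cat_cons -cats1 -[x :: y]cat1s -dy.
- by have := beq_size dy; have := beq_size dz; rewrite !size_cat /=; lia.
Qed.

Definition conjd x : 'I_n := sval (cid (conj_longest_ex x)).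

Lemma conjdP x : x :: d ~ rcons d (conjd x).
Proof. by rewrite /conjd; case: cid. Qed.

Lemma conjdPr x : rcons d x ~ conjd x :: d.
Proof.
have /beq_rev := conjdP x; rewrite rev_cons rev_rcons -!cats1.
by rewrite !beq_rev_longest.
Qed.

Lemma conjdK : involutive conjd.
Proof.
move=> x; apply/esym/beq1/(beq_cancel (p := d)).
by rewrite !cats1 conjdPr conjdP.
Qed.

Lemma conjd_words u : u ++ d ~ d ++ map conjd u.
Proof.
elim: u => [|x u IHu] /=; first by rewrite cats0.
by rewrite IHu -cat_cons conjdP cat_rcons.
Qed.

(** * The central element Delta^2 and the embedding of the monoid *)

Definition dd := d ++ d.

Lemma dd_central u : u ++ dd ~ dd ++ u.
Proof.
rewrite /dd catA (conjd_words u) -catA (conjd_words (map conjd u)) -map_comp.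
by rewrite (eq_map conjdK) map_id catA.
Qed.

Lemma star_ex x : exists y, x :: y ~ dd /\ rcons y x ~ dd.
Proof.
have /redP[y dy] := @red1 x; exists (y ++ d); split.
  by rewrite /dd -cat_cons; apply: beq_catr; exact: beq_sym dy.
rewrite rcons_cat conjdPr -cat_rcons /dd; apply: beq_catr.
apply: (beq_cancel1 (i := x)).
by rewrite conjdP -rcons_cons -!cats1; apply: beq_catr; exact: beq_sym dy.
Qed.

(** A positive word for Delta^2 s_x^-1, which replaces the inverse letter of s_x. *)
Definition star x := sval (cid (star_ex x)).

Lemma starl x : x :: star x ~ dd.
Proof. by rewrite /star; case: cid => y []. Qed.

Lemma starr x : rcons (star x) x ~ dd.
Proof. by rewrite /star; case: cid => y []. Qed.

Definition ddpow k := flatten (nseq k dd).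

Lemma ddpowD a b : ddpow (a + b) = ddpow a ++ ddpow b.
Proof. by rewrite /ddpow nseqD flatten_cat. Qed.

Lemma ddpow_central k u : u ++ ddpow k ~ ddpow k ++ u.
Proof.
elim: k => [|k IHk] /=; first by rewrite cats0.
by rewrite /ddpow /= catA dd_central -!catA IHk.
Qed.

(* Multiplying by a power of the central word [dd] removes the inverse letters,
   so a presented equality becomes an equality in the monoid. *)
Fixpoint clear_inv (w : word 'I_n) : seq 'I_n :=
  match w with
  | [::] => [::]
  | (x, b) :: w' => (if b then star x else [:: x]) ++ clear_inv w'
  end.

Definition ninv (w : word 'I_n) := count snd w.

Lemma clear_inv_cat (w1 w2 : word 'I_n) :
  clear_inv (w1 ++ w2) = clear_inv w1 ++ clear_inv w2.
Proof. by elim: w1 => [//|[x b] w IHw] /=; rewrite IHw catA. Qed.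

Lemma clear_inv_pos u : clear_inv (pos_word u) = u.
Proof. by elim: u => //= x u ->. Qed.

Lemma ninv_pos u : ninv (pos_word u) = 0%N.
Proof. by elim: u. Qed.

(** The powers of [dd] balance the numbers of inverse letters on the two sides. For positive words
    they are empty, which gives the embedding of the monoid into the group. *)
Lemma pres_eq_clear (w1 w2 : word 'I_n) : pres_eq (braid_rel M) w1 w2 ->
  ddpow (ninv w2) ++ clear_inv w1 ~ ddpow (ninv w1) ++ clear_inv w2.
Proof.
elim=> {w1 w2} [u|u v _|v u w _ IH1 _ IH2|p q u v [i j k ij Mij]|p q [x b]].
- by [].
- exact: beq_sym.
(* Transitivity: both sides are multiplied by the power belonging to the intermediate word [v],
   which is cancelled in the end. *)
- apply: (beq_cancel (p := ddpow (ninv v))).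
  rewrite !catA -!ddpowD addnC ddpowD -catA IH1 catA -ddpowD addnC ddpowD.
  by rewrite -catA IH2 !catA -!ddpowD addnC.
- rewrite /ninv !count_cat -!/(ninv _) !ninv_pos !clear_inv_cat !clear_inv_pos.
  have -> : k = bond i j by rewrite /bond Mij.
  by rewrite beq_alt.
- rewrite /ninv !count_cat -!/(ninv _) !clear_inv_cat.
  have -> : clear_inv [:: (x, b); flip (x, b)] ~ dd.
    by case: b => /=; rewrite ?cats0 ?cats1; [exact: starr|exact: starl].
  have -> : ninv [:: (x, b); flip (x, b)] = 1%N by case: b.
  have e : clear_inv p ++ dd ++ clear_inv q ~ dd ++ clear_inv p ++ clear_inv q.
    by rewrite catA dd_central -catA.
  have -> : (ninv p + (1 + ninv q) = ninv p + ninv q + 1)%N by lia.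
  rewrite e (ddpowD (ninv p + ninv q)) -catA.
  by apply: beq_catl; rewrite /ddpow /= cats0.
Qed.

Implicit Types (x y z : G).

(** * The Artin-Tits group and its prefix order *)

Definition cl u : G := \prod_(i <- u) gen M i.

Lemma cl_cat u v : cl (u ++ v) = cl u * cl v. Proof. exact: big_cat. Qed.

Lemma cl_cons i u : cl (i :: u) = gen M i * cl u. Proof. exact: big_cons. Qed.

Lemma cl_nil : cl [::] = 1. Proof. exact: big_nil. Qed.

Lemma cl1 i : cl [:: i] = gen M i.
Proof. by rewrite cl_cons cl_nil mulg1. Qed.

Lemma clE u : cl u = pres_class (braid_rel M) (pos_word u).
Proof.
elim: u => [|i u IHu]; first exact: cl_nil.
by rewrite cl_cons IHu; exact: pres_mulE.
Qed.

Lemma rev_pos u : rev (pos_word u) = pos_word (rev u).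
Proof. exact: esym (map_rev _ _). Qed.

Lemma pres_eq_rev (w1 w2 : word 'I_n) :
  pres_eq (braid_rel M) w1 w2 -> pres_eq (braid_rel M) (rev w1) (rev w2).
Proof.
elim=> {w1 w2} [u|u v _|v u w _ IH1 _ IH2|p q u v [i j k ij Mij]|p q x].
- exact: pres_refl.
- exact: pres_sym.
- exact: pres_trans IH1 IH2.
- rewrite !rev_cat -!catA; apply: pres_rel.
  rewrite !rev_pos !rev_alt; case: (odd k); first exact: BraidRel.
  by apply: BraidRel; rewrite 1?eq_sym // Msym.
- rewrite !rev_cat -!catA -{1}[x]flipK; exact: pres_cancel.
Qed.

(* The anti-automorphism fixing the generators; it exchanges prefixes and
   suffixes. *)
Definition rho x : G := pres_class (braid_rel M) (rev (repr x)).

Lemma rho_class (w : word 'I_n) : rho (pres_class (braid_rel M) w) =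
  pres_class (braid_rel M) (rev w).
Proof. by apply/pres_classP/pres_eq_rev/pres_repr_eq. Qed.

Lemma rhoM x y : rho (x * y) = rho y * rho x.
Proof.
rewrite -[x]pres_repr -[y]pres_repr [_ * _]pres_mulE !rho_class.
by rewrite [_ * _]pres_mulE rev_cat.
Qed.

Lemma rhoK : involutive rho.
Proof. by move=> x; rewrite -[x]pres_repr !rho_class revK. Qed.

Lemma rho1 : rho 1 = 1.
Proof. exact: rho_class. Qed.

Lemma rhoV x : rho x^-1 = (rho x)^-1.
Proof. by apply/esym/mulg1_eq; rewrite -rhoM mulVg rho1. Qed.

Lemma rho_cl u : rho (cl u) = cl (rev u).
Proof. by rewrite !clE rho_class rev_pos. Qed.

Lemma rho_gen i : rho (gen M i) = gen M i.
Proof. by rewrite -cl1 rho_cl. Qed.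

Lemma positive_rho x : positive (rho x) <-> positive x.
Proof.
suff h y : positive y -> positive (rho y) by split=> [/h|/h //]; rewrite rhoK.
by case=> u ->; exists (rev u); exact: rho_cl.
Qed.

Lemma suffix_le_rho x y : suffix_le x y <-> prefix_le (rho x) (rho y).
Proof. by rewrite /suffix_le -positive_rho rhoM rhoV. Qed.

Lemma positiveM x y : positive x -> positive y -> positive (x * y).
Proof. by move=> [u ->] [v ->]; exists (u ++ v); exact: esym (cl_cat u v). Qed.

Lemma positive_cl u : positive (cl u). Proof. by exists u. Qed.

Lemma prefix_le1 x : prefix_le 1 x <-> positive x.
Proof. by rewrite /prefix_le invg1 mul1g. Qed.

Lemma prefix_le_trans y x z : prefix_le x y -> prefix_le y z -> prefix_le x z.
Proof.
rewrite /prefix_le => h1 h2; have := positiveM h1 h2.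
by rewrite mulgA mulgK.
Qed.

Lemma prefix_le_mul2l z x y : prefix_le (z * x) (z * y) <-> prefix_le x y.
Proof. by rewrite /prefix_le invgM -!mulgA mulKg. Qed.

Lemma cl_beq u v : cl u = cl v <-> u ~ v.
Proof.
split.
  rewrite !clE => /pres_classP /(pres_eq_clear).
  by rewrite !ninv_pos !clear_inv_pos.
elim=> {u v} [//|u v _ -> //|v u w _ -> _ -> //|p q i j ij].
rewrite !cl_cat; congr (_ * (_ * _)); rewrite !clE; apply/pres_classP.
rewrite -[X in pres_eq _ X _]cats0 -[X in pres_eq _ _ X]cats0.
by apply: (@pres_rel _ _ [::] [::]); constructor=> //; exact: bondE.
Qed.

Lemma prefix_le_cl u v : prefix_le (cl u) (cl v) <-> ldvd u v.
Proof.
split=> [[r h]|[r /cl_beq ->]].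
  exists r; apply/cl_beq; rewrite cl_cat -[X in _ * X]/(\prod_(i <- r) gen M i).
  by rewrite -h mulVKg.
by rewrite cl_cat /prefix_le mulKg; exact: positive_cl.
Qed.

Lemma positive_antisym x : positive x -> positive x^-1 -> x = 1.
Proof.
case=> u hu [v hv]; have : u ++ v ~ [::].
  by apply/cl_beq; rewrite cl_cat cl_nil /cl -hu -hv mulgV.
by move=> /beq_size; case: u hu => // -> _; exact: cl_nil.
Qed.

Lemma prefix_le_antisym x y : prefix_le x y -> prefix_le y x -> x = y.
Proof.
move=> h1 h2; have e : x^-1 * y = 1.
  by apply: positive_antisym => //; rewrite invgM invgK.
by rewrite -[y](mulVKg x) e mulg1.
Qed.

(* The longest reduced word u dividing w is divisible by the lcm of u and any
   letter dividing w, hence by every such letter. *)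
Lemma letters_ldvd w : (forall i, ldvd [:: i] w) -> ldvd d w.
Proof.
move=> hw; pose P k := `[< exists u, [/\ red u, ldvd u w & size u = k] >].
have exP : exists k, P k.
  exists 0%N; apply/asboolP; exists [::].
  by split; [exact: red_nil|exact: ldvd_nil|].
have ubP k : P k -> (k <= size w)%N.
  move=> /asboolP[u [_ [r /beq_size + <-]]]; rewrite size_cat; lia.
case: (ex_maxnP exP ubP) => k /asboolP[u [ru uw <-]] kmax.
apply: (ldvd_trans _ uw); apply/red_ldvd_longest => // i ri.
have [l [[r ulr] il lw univ]] := ldvd_lcm uw (hw i).
have rl : red l by apply/redP/univ; apply/redP => //; exact: red1.
have : P (size l) by apply/asboolP; exists l.
move=> /kmax; rewrite (beq_size ulr) size_cat.
case: r ulr => [|j r] ulr /=; last by lia.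
rewrite cats0 in ulr; rewrite ulr in il; case: il => v uv.
have rii : red (i :: i :: v) by apply: (beq_red _ ri); rewrite uv.
by case: (nred_double rii).
Qed.

Lemma lcm_longest : is_lcm (@prefix_le n M) (@atoms n M) (cl d).
Proof.
split=> [_ [i _ <-]|z hz].
  by rewrite -cl1; apply/prefix_le_cl/redP/red1.
have [w hw] : positive z.
  case: hM => n2 _ _ _ _; pose i : 'I_n := Ordinal (ltnW n2).
  have iz : prefix_le (gen M i) z by apply: hz; exists i.
  apply/prefix_le1; apply: (prefix_le_trans _ iz); apply/prefix_le1.
  by rewrite -cl1; exact: positive_cl.
rewrite hw; apply/prefix_le_cl/letters_ldvd => i.
by apply/prefix_le_cl; rewrite cl1 /cl -hw; apply: hz; exists i.
Qed.

Lemma rho_longest : rho (cl d) = cl d.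
Proof. by rewrite rho_cl; apply/cl_beq/(beq_rev_longest). Qed.

(** The suffix half follows from the prefix half through [rho], which fixes the generators and the
    longest element; antisymmetry gives uniqueness. *)
Lemma DeltaE : Delta M = cl d.
Proof.
apply: xget_unique => [|b [[b1 b2] _]]; last first.
  have [a1 a2] := lcm_longest; apply: prefix_le_antisym; [exact: b2|exact: a2].
split; first exact: lcm_longest.
have [a1 a2] := lcm_longest; split=> [_ [i _ <-]|z hz].
  rewrite suffix_le_rho rho_gen rho_longest.
  by apply: a1; exists i.
rewrite suffix_le_rho rho_longest; apply: a2 => _ [i _ <-].
by rewrite -rho_gen -suffix_le_rho; apply: hz; exists i.
Qed.

Lemma simpleP x : simple x <-> exists2 u, red u & x = cl u.
Proof.
rewrite /simple DeltaE prefix_le1; split=> [[[u ->] /prefix_le_cl/redP]|[u ru ->]].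
  by exists u.
by split; [exact: positive_cl|apply/prefix_le_cl/redP].
Qed.

Lemma gen_longest i : gen M i * cl d = cl d * gen M (conjd i).
Proof. by rewrite -cl_cons -cl1 -cl_cat; apply/cl_beq; rewrite cats1 conjdP. Qed.

Lemma central_gens z : (forall i, commute z (gen M i)) -> forall x, commute z x.
Proof.
move=> hz x; rewrite -[x]pres_repr; elim: (repr x) => [|[i b] w IHw].
  exact: commute1.
rewrite -cat1s -pres_mulE; apply: commuteM => //.
case: b; last exact: hz.
by rewrite -[pres_class _ _](pres_invE _ [:: (i, false)]); exact/commuteV/hz.
Qed.

Lemma cl_dd_central x : commute (cl dd) x.
Proof.
apply: central_gens => i; rewrite /commute -cl1 -!cl_cat; apply/cl_beq.
exact/beq_sym/dd_central.
Qed.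

Lemma tau_tau x : tau (tau x) = x.
Proof.
rewrite /tau DeltaE !mulgA -invgM -!mulgA -cl_cat -[d ++ d]/dd.
by rewrite -(cl_dd_central x) mulKg.
Qed.

Lemma tau_gen i : tau (gen M i) = gen M (conjd i).
Proof. by rewrite /tau DeltaE -mulgA gen_longest mulKg. Qed.

Lemma iter_tau_double k x : iter k.*2 (@tau n M) x = x.
Proof. by elim: k => //= k IHk; rewrite IHk tau_tau. Qed.

(** Since tau^2 is the identity, the order of tau is 1 or 2. *)
Lemma order_tau_even k : (order_tau M %| k.*2)%N.
Proof.
have [o1 o2] : (0 < order_tau M)%N /\ (order_tau M <= 2)%N.
  have : exists o, [/\ (0 < o)%N, iter o (@tau n M) =1 id &
      forall m, (0 < m)%N -> iter m (@tau n M) =1 id -> (o <= m)%N].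
    have [h|h] := pselect (iter 1 (@tau n M) =1 id); first by exists 1%N.
    exists 2%N; split=> //; first by move=> x; exact: (iter_tau_double 1).
    by case=> [|[|k']] // _ h1; case: (h h1).
  move=> ex; have [h1 h2 h3] := xgetPex 0%N ex; split=> //.
  by apply: h3 => // x; exact: (iter_tau_double 1).
apply: (@dvdn_trans 2); last by rewrite -muln2 dvdn_mull.
by case: (order_tau M) o1 o2 => [|[|[|o]]].
Qed.

Lemma cl_clear_inv (w : word 'I_n) :
  cl (clear_inv w) = cl dd ^+ ninv w * pres_class (braid_rel M) w.
Proof.
elim: w => [|[i b] w IHw]; first by rewrite cl_nil mul1g.
rewrite [clear_inv _]/= cl_cat IHw -[_ :: w]cat1s -pres_mulE /ninv /= -/(ninv w).
have c := commuteX (ninv w) (commute_sym (cl_dd_central (cl [:: i]))).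
case: b => /=; last first.
  rewrite add0n !mulgA; congr (_ * _); rewrite c; congr (_ * _).
  by rewrite clE.
have -> : pres_class (braid_rel M) [:: (i, true)] = (gen M i)^-1.
  exact: esym (pres_invE _ [:: (i, false)]).
rewrite add1n expgS !mulgA; congr (_ * _).
have -> : cl (star i) = cl dd * (gen M i)^-1.
  apply: (mulIg (gen M i)); rewrite mulgVK -cl1 -cl_cat.
  by apply/cl_beq; rewrite cats1 starr.
rewrite -!mulgA; congr (_ * _); rewrite cl1 in c.
exact: commute_sym (commuteV (commute_sym c)).
Qed.

(** The gcd in [left_weighted] quantifies over all group elements; replacing [z] by its lcm with 1
    reduces to positive ones. Multiplication by a central power of Delta^2 moves the question into
    the monoid. *)
Lemma lcm_with_1 z : exists l : G, [/\ prefix_le z l, prefix_le 1 l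
  & forall y, prefix_le z y -> prefix_le 1 y -> prefix_le l y].
Proof.
pose w := repr z; have ez := cl_clear_inv w; rewrite pres_repr in ez.
have e1 : cl (ddpow (ninv w)) = cl dd ^+ ninv w.
  by elim: (ninv w) => [|k IHk]; [exact: cl_nil|rewrite cl_cat IHk expgS].
pose y := clear_inv w ++ ddpow (ninv w).
have [||l [al bl ly univ]] := @ldvd_lcm y (clear_inv w) (ddpow (ninv w)).
- exact: ldvd_cat.
- by rewrite /y ddpow_central //; exact: ldvd_cat.
set c := cl dd ^+ ninv w in ez e1.
exists (c^-1 * cl l); split.
- by rewrite -(prefix_le_mul2l c) mulVKg -ez; apply/prefix_le_cl.
- by rewrite -(prefix_le_mul2l c) mulVKg mulg1 -e1; apply/prefix_le_cl.
- move=> x; rewrite -[prefix_le z x](prefix_le_mul2l c).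
  rewrite -[prefix_le 1 x](prefix_le_mul2l c).
  rewrite -[prefix_le _ x](prefix_le_mul2l c) mulVKg -ez mulg1 => h1.
  rewrite -{1}e1 => h2.
  have [v hv] : positive (c * x).
    apply/prefix_le1; apply: prefix_le_trans h1; rewrite prefix_le1.
    exact: positive_cl.
  rewrite [c * x]hv in h1 h2 *; apply/prefix_le_cl/univ; exact/prefix_le_cl.
Qed.

(** * Normal forms *)

Lemma left_descentP i u : red u -> ~ red (i :: u) <-> ldvd [:: i] u.
Proof.
move=> ru; split=> [nr|[v uv] r]; last first.
  have := nred_double (x := i) (u := v); apply.
  by apply: (beq_red _ r); rewrite uv.
have [a [x [b [e h]]]] := exchange ru nr.
have e2 : wprod (i :: a ++ b) = wprod u.
  by rewrite wprod_cons -h mulgA refl_sq mul1g.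
exists (a ++ b); apply: matsumoto => //.
by apply: (red_eq ru e2); rewrite e /= !size_cat /= addnS.
Qed.

Lemma red_rcons_rev i u : red (rcons u i) <-> red (i :: rev u).
Proof.
rewrite -[rcons u i]revK rev_rcons; split=> /red_rev //.
by rewrite revK.
Qed.

Lemma right_descentP i u : red u -> ~ red (rcons u i) <-> exists v, u ~ rcons v i.
Proof.
move=> ru; rewrite red_rcons_rev left_descentP; last exact: red_rev.
split=> -[v h].
  by exists (rev v); rewrite -rev_cons -[u]revK; exact: beq_rev.
by exists (rev v); have := beq_rev h; rewrite rev_rcons.
Qed.

(** In contrapositive form: every left descent of [v] is a right descent of [u]. *)
Definition weighted u v := `[< forall i, red (rcons u i) -> red (i :: v) >].

Lemma weightedP u v :
  reflect (forall i, red (rcons u i) -> red (i :: v)) (weighted u v).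
Proof. exact: asboolP. Qed.

(** A positive common prefix other than 1 starts with a letter i; then u i divides Delta, hence is
    reduced, while i is a left descent of [v]. *)
Lemma left_weightedP u v : red u -> red v ->
  left_weighted (cl u) (cl v) <-> weighted u v.
Proof.
move=> ru rv; rewrite /left_weighted DeltaE.
split=> [[_ _ h]|/weightedP h].
  apply/weightedP => i ri; apply: contrapT => /(left_descentP _ rv) iv.
  have : prefix_le (gen M i) 1.
    apply: h; rewrite -cl1; last exact/prefix_le_cl.
    rewrite -(prefix_le_mul2l (cl u)) mulVKg -cl_cat; apply/prefix_le_cl.
    by rewrite cats1; apply/redP.
  rewrite /prefix_le mulg1 => pV.
  have := positive_antisym (x := gen M i) _ pV.
  rewrite -cl1 => /(_ (positive_cl _)); rewrite -cl_nil.
  by move=> /cl_beq/beq_size.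
have pu : prefix_le 1 ((cl u)^-1 * cl d).
  by apply/prefix_le1; move/redP/prefix_le_cl: ru.
split=> //; first exact/prefix_le1/positive_cl.
move=> z z1 z2; have [l [zl ol univ]] := lcm_with_1 z.
suff -> : 1 = l by [].
have l2 : prefix_le l (cl v) by apply: univ => //; exact/prefix_le1/positive_cl.
have l1 : prefix_le l ((cl u)^-1 * cl d).
  exact: univ.
have /prefix_le1[w lw] := ol; rewrite -[\prod_(_ <- _) _]/(cl w) in lw.
rewrite lw; case: w lw => [|i w] lw; first by rewrite cl_nil.
rewrite lw in l1 l2; move/prefix_le_cl: l2 => l2.
move: l1; rewrite -(prefix_le_mul2l (cl u)) mulVKg -cl_cat => /prefix_le_cl/redP.
rewrite -cat_rcons => /red_catl/h ri.
have /(left_descentP i rv) : ldvd [:: i] v by apply: ldvd_trans l2; exists w.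
by case.
Qed.

Lemma right_weightedP u v : red u -> red v ->
  right_weighted (cl u) (cl v) <-> forall i, red (i :: v) -> red (rcons u i).
Proof.
move=> ru rv; have rU := red_rev ru; have rV := red_rev rv.
transitivity (left_weighted (cl (rev v)) (cl (rev u))).
  rewrite /right_weighted /left_weighted DeltaE.
  have e : rho (cl d / cl v) = (cl (rev v))^-1 * cl d.
    by rewrite rhoM rhoV rho_cl (rho_longest).
  split=> -[h1 h2 h3]; split.
  - by move: h2; rewrite suffix_le_rho e rho1.
  - by move: h1; rewrite suffix_le_rho rho_cl rho1.
  - move=> z z1 z2; have := h3 (rho z); rewrite !suffix_le_rho rhoK.
    by rewrite e rho_cl rho1; apply.
  - by rewrite suffix_le_rho rho_cl rho1.
  - by rewrite suffix_le_rho e rho1.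
  - move=> z; rewrite !suffix_le_rho e rho_cl rho1 => z1 z2.
    exact: h3.
rewrite left_weightedP //; split=> [/weightedP h i ri|h].
  by rewrite red_rcons_rev; apply: h; rewrite red_rcons_rev revK.
by apply/weightedP => i; rewrite red_rcons_rev revK => /h; rewrite red_rcons_rev.
Qed.

Definition nf_words (us : seq (seq 'I_n)) :=
  sorted weighted us /\ forall u, u \in us -> red u.

Lemma nf_words_behead u us : nf_words (u :: us) -> nf_words us.
Proof.
move=> [h1 h2]; split; first exact: path_sorted h1.
by move=> v vus; apply: h2; rewrite inE vus orbT.
Qed.

Lemma nf_words_head u us : nf_words (u :: us) -> red u.
Proof. by case=> _; apply; rewrite mem_head. Qed.

(** The lcm of [t] and [u] is simple. If it were longer than [u], its next letter i would divide the
    remaining product, hence the next factor [v] by induction, although u i is reduced; this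
    contradicts weightedness. *)
Lemma nf_words_ldvd t u us : nf_words (u :: us) -> red t ->
  ldvd t (flatten (u :: us)) -> ldvd t u.
Proof.
elim: us t u => [|v us IHus] t u nfu rt; first by rewrite /= cats0.
move=> tF; have ru := nf_words_head nfu.
have uF : ldvd u (flatten [:: u, v & us]) by exact: ldvd_cat.
have [l [tl [f lf] lF univ]] := ldvd_lcm tF uF.
have rl : red l by apply/redP/univ; exact/redP.
case: f lf => [|i f] lf; first by rewrite cats0 in lf; rewrite -lf.
rewrite lf in lF rl; rewrite -cat_rcons in rl.
have iv : ldvd [:: i] v.
  apply: IHus; [exact: nf_words_behead nfu|exact: red1|].
  case: lF => r; rewrite -catA => /beq_cancel h.
  by exists (f ++ r).
have rv := nf_words_head (nf_words_behead nfu).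
case: nfu => /= /andP[/weightedP w _] _.
by move/(left_descentP i rv): iv; case; apply: w; exact: red_catl rl.
Qed.

Lemma nf_words_uniq us vs : nf_words us -> nf_words vs -> size us = size vs ->
  flatten us ~ flatten vs -> map cl us = map cl vs.
Proof.
elim: us vs => [|u us IHus] [|v vs] //= nu nv [sz] e.
have uv : ldvd u v.
  apply: (nf_words_ldvd nv) (nf_words_head nu) _.
  by rewrite /= -e; exact: ldvd_cat.
have vu : ldvd v u.
  apply: (nf_words_ldvd nu) (nf_words_head nv) _.
  by rewrite /= e; exact: ldvd_cat.
have {vu} uv : u ~ v.
  by apply/cl_beq/prefix_le_antisym; exact/prefix_le_cl.
rewrite (proj2 (cl_beq _ _) uv) (IHus vs) //.
- exact: nf_words_behead nu.
- exact: nf_words_behead nv.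
by apply: (@beq_cancel u); rewrite e uv.
Qed.

Lemma simple_words (xs : seq G) : (forall s, s \in xs -> simple s /\ s <> 1) ->
  exists2 us, xs = map cl us & forall u, u \in us -> red u.
Proof.
elim: xs => [|x xs IHxs] h; first by exists [::].
have [|us -> rus] := IHxs; first by move=> s sx; apply: h; rewrite inE sx orbT.
have [/simpleP[u ru ->] _] := h x (mem_head _ _).
by exists (u :: us) => // v; rewrite inE => /orP[/eqP ->|/rus].
Qed.

Lemma prod_cl us : \prod_(x <- map cl us) x = cl (flatten us).
Proof.
elim: us => [|u us IHus]; first by rewrite big_nil cl_nil.
by rewrite big_cons IHus /= cl_cat.
Qed.

Lemma left_nf_words x xs : is_left_nf x xs ->
  exists2 us, xs = map cl us & nf_words us.
Proof.
case=> _ _ /simple_words[us -> rus] _ w; exists us => //; split=> //.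
apply/(sortedP [::]) => i si; apply/left_weightedP; try exact/rus/mem_nth/ltnW.
  exact/rus/mem_nth.
by have := w i; rewrite size_map !(nth_map [::]) // ?(ltnW si) //; apply.
Qed.

(** * Inf and sup of a product in normal form *)

Definition dpow k := flatten (nseq k d).

Lemma cl_dpow k : cl (dpow k) = Delta M ^+ k.
Proof.
by rewrite DeltaE; elim: k => [|k IHk]; [exact: cl_nil|rewrite cl_cat IHk expgS].
Qed.

Lemma dpowD a b : dpow (a + b) = dpow a ++ dpow b.
Proof. by rewrite /dpow nseqD flatten_cat. Qed.

Lemma dpow_conj k u : exists v, u ++ dpow k ~ dpow k ++ v.
Proof.
elim: k u => [|k IHk] u; first by exists u; rewrite cats0.
have [v hv] := IHk (map conjd u); exists v.
by rewrite /dpow /= catA conjd_words -!catA hv.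
Qed.

Lemma map_conjd_longest : map conjd d ~ d.
Proof. by apply: (@beq_cancel d); rewrite -conjd_words. Qed.

Lemma map_conjd_beq u v : u ~ v -> map conjd u ~ map conjd v.
Proof.
by move=> uv; apply: (@beq_cancel d); rewrite -!conjd_words uv.
Qed.

Lemma red_conjd u : red (map conjd u) <-> red u.
Proof.
suff h v : red v -> red (map conjd v).
  split=> [/h|/h //]; by rewrite -map_comp (eq_map conjdK) map_id.
move=> /redP[y dy]; apply/redP; exists (map conjd y).
by rewrite -map_cat -(map_conjd_beq dy) map_conjd_longest.
Qed.

Lemma weighted_conjd u v : weighted u v -> weighted (map conjd u) (map conjd v).
Proof.
move=> /weightedP w; apply/weightedP => i.
by rewrite -[i]conjdK -map_rcons -map_cons !red_conjd; exact: w.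
Qed.

Lemma nf_words_conjd us : nf_words us -> nf_words (map (map conjd) us).
Proof.
case=> s r; split.
  by rewrite sorted_map; apply: sub_sorted s => u v; exact: weighted_conjd.
by move=> _ /mapP[u /r ru ->]; apply/red_conjd.
Qed.

Lemma complement_left u v i : d ~ u ++ v -> red (i :: v) <-> ~ red (rcons u i).
Proof.
move=> duv; have ruv := beq_red duv rd.
have ru := red_catl ruv; have rv := red_catr ruv.
split=> [ri ru'|nr].
  have /redP[y dy] := ru'; rewrite cat_rcons duv in dy.
  have e : v ~ i :: y by apply: beq_cancel dy.
  have r2 : red (i :: i :: y) by apply: (beq_red _ ri); rewrite e.
  by case: (nred_double r2).
move/(right_descentP i ru): nr => [w uw].
by apply: (@red_catr w); rewrite -cat_rcons -uw -duv.
Qed.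

Lemma weighted_complement u v u' v' : d ~ u ++ u' -> d ~ v ++ v' ->
  weighted u v -> weighted v' (map conjd u').
Proof.
move=> du dv /weightedP w; apply/weightedP => i ri.
have dv' : d ~ v' ++ map conjd v.
  apply: (@beq_cancel v); rewrite catA conjd_words; exact: beq_catr.
have h1 : ~ red (i :: map conjd v) by rewrite (complement_left i dv').
have e p : red (i :: map conjd p) <-> red (conjd i :: p).
  by rewrite -{1}[i]conjdK -map_cons red_conjd.
by apply/e/(complement_left _ du) => /w; rewrite -e.
Qed.

(** If x has r factors, those of x^-1 Delta^r are the complements of the factors of x in reverse
    order, twisted by powers of tau. The list [vs] runs backwards so that its head is the last
    factor of x, which is matched with the first factor of the complement. *)
Lemma nf_complement vs : nf_words (rev vs) -> exists cs,
  [/\ size cs = size vs, nf_words cs,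
      flatten (rev vs) ++ flatten cs ~ dpow (size vs)
    & forall v vs' c cs', vs = v :: vs' -> cs = c :: cs' -> d ~ v ++ c].
Proof.
elim: vs => [|v vs IHvs]; first by exists [::]; split.
rewrite rev_cons => nf; have [s r] := nf.
have rv : red v by apply: r; rewrite mem_rcons mem_head.
have nfv : nf_words (rev vs).
  split; last by move=> u uvs; apply: r; rewrite mem_rcons inE uvs orbT.
  by move: s; rewrite -cats1 => /cat_sorted2[].
have [cs [sz nfc e h]] := IHvs nfv.
have /redP[c dc] := rv.
have rc : red c by apply: (@red_catr v); exact: beq_red dc rd.
exists (c :: map (map conjd) cs); split=> /=.
- by rewrite size_map sz.
- have [s' r'] := nf_words_conjd nfc; split; last first.
    by move=> u; rewrite inE => /orP[/eqP ->|/r'].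
  case: cs vs sz s' h s {IHvs nf r nfv nfc e r'} => [|c' cs] [|v' vs] //= _ s' h s.
  rewrite s' andbT; apply: (weighted_complement (h _ _ _ _ erefl erefl) dc).
  by move: s; rewrite rev_cons -!cats1 -catA => /cat_sorted2[_] /= /andP[].
- rewrite -cats1 flatten_cat /= cats0 -catA [v ++ _]catA.
  rewrite -dc.
  have -> : flatten [seq map conjd u | u <- cs] = map conjd (flatten cs).
    by rewrite map_flatten.
  rewrite -conjd_words catA e -[X in _ ~ dpow X]addn1 dpowD.
  by rewrite /(dpow 1) /= cats0.
- by move=> ? ? ? ? [<- _] [<- _].
Qed.

Lemma ginf_nf u us : nf_words (u :: us) -> ~ ldvd d u ->
  ginf (cl (flatten (u :: us))) = 0%R.
Proof.
move=> nf nu; set x := cl _.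
have h0 : prefix_le (expgz (Delta M) 0%R) x by apply/prefix_le1; exact: positive_cl.
have h1 k : prefix_le (expgz (Delta M) k) x -> (k <= 0)%R.
  case: k => [[|k]|k] //=; rewrite -cl_dpow => /prefix_le_cl dF.
  case: nu; apply: (nf_words_ldvd nf rd); apply: ldvd_trans dF.
  exact: ldvd_cat.
apply: xget_unique => // k [k1 k2]; apply/eqP; rewrite eq_le.
by rewrite h1 // k2.
Qed.

(** If x divided Delta^k with k smaller than the number r of factors, then Delta would divide the
    complement of x in Delta^r, hence its first factor; the last factor of x would be trivial. *)
Lemma gsup_nf us : (0 < size us)%N -> nf_words us ->
  (forall u, u \in us -> u != [::]) ->
  gsup (cl (flatten us)) = (size us)%:Z%R.
Proof.
move=> us0 nf ne; set x := cl _.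
have [cs [sz nfc]] := nf_complement (vs := rev us) (eq_ind_r nf_words nf (revK us)).
rewrite revK size_rev => e hc; rewrite size_rev in sz.
have h0 : prefix_le x (expgz (Delta M) (size us)%:Z%R).
  by rewrite /= -cl_dpow; apply/prefix_le_cl; exists (flatten cs); rewrite e.
have h1 k : (k < size us)%N -> ~ prefix_le x (Delta M ^+ k).
  move=> ks; rewrite -cl_dpow => /prefix_le_cl[y hy].
  have [z hz] := dpow_conj (size us - k).-1.+1 y.
  have ds : dpow (size us) = dpow k ++ dpow (size us - k).-1.+1.
    by rewrite -dpowD; congr dpow; lia.
  have dcs : ldvd d (flatten cs).
    exists (dpow (size us - k).-1 ++ z); apply: (@beq_cancel (flatten us)).
    by rewrite e ds hy -catA hz -!catA.
  case: (rev us) hc (size_rev us) (fun u => mem_rev us u) => [|v vs] hc.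
    by move=> /esym s0; rewrite s0 in us0.
  case: cs sz nfc {e} dcs hc => [/esym s0|c cs sz nfc dcs hc _ mr].
    by rewrite s0 in us0.
  have dvc := hc _ _ _ _ erefl erefl.
  have dc : ldvd d c by apply: (nf_words_ldvd nfc rd dcs).
  have /ne : v \in us by rewrite -mr mem_head.
  case: dc => r cr; rewrite cr in dvc; have := beq_size dvc.
  by case: (v) => //= ? ?; rewrite !size_cat; lia.
have h2 k : prefix_le x (expgz (Delta M) k) -> ((size us)%:Z <= k)%R.
  case: k => k /= hk.
    by rewrite lez_nat leqNgt; apply/negP => /h1 /(_ hk).
  case: (h1 0%N us0) => //=; apply: (prefix_le_trans hk).
  rewrite /prefix_le invgK mulg1 -cl_dpow; exact: positive_cl.
apply: xget_unique => // k [k1 k2]; apply/eqP; rewrite eq_le.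
by rewrite h2 // k2.
Qed.

(** * Words with prescribed descents *)

Lemma mem_alt i j k (x : 'I_n) : (2 <= k)%N ->
  (x \in alternating i j k) = (x == i) || (x == j).
Proof.
case: k => [|[|k]] // _; rewrite !altS !inE orbA.
apply/idP/idP => [/orP[//|/alt_letters[->|->]]|-> //]; first by rewrite eqxx.
by rewrite eqxx orbT.
Qed.

Lemma beq_mem u v : u ~ v -> u =i v.
Proof.
elim=> {u v} [//|u v _ h x|v u w _ h1 _ h2 x|p q i j ij x]; rewrite ?h ?h1 //.
by rewrite !mem_cat !mem_alt ?bond_ge2 // [X in _ || (X || _)]orbC.
Qed.

Lemma edge_bond i j : coxeter_edge M i j = (i != j) && (3 <= bond i j)%N.
Proof.
by rewrite /coxeter_edge; case: (boolP (i == j)) => //= ij; rewrite bondE.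
Qed.

Lemma edge_sym : symmetric (coxeter_edge M).
Proof. by move=> i j; rewrite !edge_bond eq_sym bondC. Qed.

Definition rdesc u (I : {set 'I_n}) := forall i, red (rcons u i) <-> i \notin I.
Definition ldesc u (I : {set 'I_n}) := forall i, red (i :: u) <-> i \notin I.

(* The word w is w_I s, with w_I the longest element of the parabolic subgroup
   generated by I. *)
Lemma slide_word (I : {set 'I_n}) s t :
  s \notin I -> t \in I -> coxeter_edge M s t -> exists w,
  [/\ red w, (2 <= size w)%N, ldesc w I & rdesc w (slide (coxeter_edge M) s I)].
Proof.
move=> sI tI est; have [c [rc cI lc rcI]] := longest_red (mem I).
have sc : s \notin c by apply: contra sI => /cI.
have := est; rewrite edge_bond => /andP[st m3].
have [c' tc] : ldvd [:: t] c by apply/left_descentP => //; exact: lc.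
have rw : red (rcons c s).
  apply: contrapT => /(right_descentP _ rc)[v cv].
  by move: sc; rewrite (beq_mem cv) mem_rcons mem_head.
exists (rcons c s); split=> //.
- by rewrite size_rcons (beq_size tc).
- move=> i; split=> [ri|iI].
    apply/negP => iI; have /(left_descentP i rc)[v cv] := lc i iI.
    have r2 : red (i :: i :: rcons v s).
      by apply: (beq_red _ ri); rewrite -!cats1 cv.
    by case: (nred_double r2).
  apply: contrapT => nr; have [v wv] : ldvd [:: i] (rcons c s).
    exact/left_descentP.
  have : i \in rcons c s by rewrite (beq_mem wv) mem_head.
  rewrite mem_rcons inE => /orP[/eqP ei|/cI]; last by rewrite /= (negbTE iI).
  rewrite {}ei {i iI wv v} in nr.
  (* Suppose s is a left descent. The exchanged letter cannot lie in [c], else s would be a left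
     descent of [c]. So s c = c s, which both s and t divide on the left; as they are adjacent, [c]
     would contain s. *)
  have [a [y [b [e h]]]] := exchange rw nr.
  have [[b' eb]|eb] : (exists b', b = rcons b' s) \/ b = [::].
    case/lastP: b e {h} => [|b' z] e; [by right|left; exists b'].
    by move: e; rewrite -rcons_cons -rcons_cat => /rcons_inj[_ ->].
    have ec : c = a ++ y :: b'.
      by move: e; rewrite eb -rcons_cons -rcons_cat => /rcons_inj[].
    have hc : refl s * wprod c = wprod (a ++ b').
      apply: (mulIg (refl s)); rewrite -[X in _ * X](wprod1 M s) -mulgA.
      by rewrite -wprod_cat cats1 h eb -cats1 catA (wprod_cat M _ [:: s]) wprod1.
    have /(left_descentP s rc)[v cv] : ~ red (s :: c).
      move=> /(_ (a ++ b')); rewrite -hc wprod_cons => /(_ erefl).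
      by rewrite /= ec !size_cat /= addnS -ltnS; lia.
    by move: sc; rewrite (beq_mem cv) mem_head.
  have {e} [ea _] : c = a /\ s = y by move: e; rewrite eb cats1 => /rcons_inj[].
  rewrite eb cats0 -ea -cats1 wprod_cat wprod1 in h.
  have e2 : wprod (s :: c) = wprod (rcons c s).
    apply: (mulIg (refl s)).
    by rewrite wprod_cons -mulgA h -cats1 wprod_cat wprod1 -mulgA refl_sq mulg1.
  have rsc : red (s :: c) by apply: (red_eq rw e2); rewrite size_rcons.
  have : s :: c ~ t :: rcons c' s.
    rewrite -[_ :: rcons c' s]/(rcons ([:: t] ++ c') s) -cats1 -tc cats1.
    exact: matsumoto.
  move/beq_head; rewrite /= (negbTE st) => -[v [cv _]].
  by move: sc; rewrite (beq_mem cv) mem_cat mem_alt ?eqxx ?orbT //; lia.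
- move=> i; split=> [ri|iJ].
    apply/negP; rewrite !inE => /orP[/eqP ei|/andP[iI ie]].
      move: ri => /red_rev; rewrite ei !rev_rcons; exact: nred_double.
    have si : s != i by apply: contraNneq sI => ->.
    have m2 : bond s i = 2%N.
      by have := bond_ge2 si; move: ie; rewrite edge_bond si /=; lia.
    have /(right_descentP i rc)[v cv] := rcI i iI.
    have e : rcons (rcons c s) i ~ rcons (rcons (rcons v s) i) i.
      rewrite -!cats1 -!catA cv -!cats1 -!catA; apply: beq_catl.
      by have := beq_catr [:: i] (beq_alt si); rewrite m2 => /beq_sym.
    by have /red_rev := beq_red e ri; rewrite !rev_rcons; exact: nred_double.
  (* A right descent i other than s makes c s divisible on the right by the lcm of i and s; if i and
     s were adjacent, [c] would contain s. *)
  apply: contrapT => /(right_descentP i rw)[v wv].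
  have si : s != i by apply: contraNneq iJ => ->; rewrite setU11.
  have := beq_rev wv; rewrite !rev_rcons => /beq_head.
  rewrite /= (negbTE si) => -[h [ch _]].
  have m2 := bond_ge2 si.
  have ic : i \in c.
    rewrite -mem_rev (beq_mem ch).
    have -> : (bond s i).-1 = (bond s i).-2.+1 by lia.
    by rewrite altS mem_head.
  move: iJ; rewrite !inE eq_sym (negbTE si) (cI _ ic) /= negbK edge_bond si /=.
  move=> m3i.
  by move: sc; rewrite -mem_rev (beq_mem ch) mem_cat mem_alt ?eqxx ?orbT //; lia.
Qed.

(** * The sequence of factors of x_G *)

Definition linked u v := `[< forall i, red (rcons u i) <-> red (i :: v) >].

Lemma linkedP u v :
  reflect (forall i, red (rcons u i) <-> red (i :: v)) (linked u v).
Proof. exact: asboolP. Qed.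

Lemma linked_rev u v : linked u v -> linked (rev v) (rev u).
Proof.
move=> /linkedP h; apply/linkedP => i.
by rewrite red_rcons_rev revK -h red_rcons_rev.
Qed.

Lemma slides_words I J u : slides (coxeter_edge M) I J -> rdesc u I ->
  exists ws, [/\ path linked u ws, forall w, w \in ws -> red w /\ (2 <= size w)%N
    & rdesc (last u ws) J].
Proof.
move=> h; elim: h u => {I J} [I u uI|I s t J sI tI st _ IH u uI].
  by exists [::].
have [w [rw sw wI wJ]] := slide_word sI tI st.
have [ws [pw hw lJ]] := IH w wJ.
exists (w :: ws); split=> //=.
  by rewrite pw andbT; apply/linkedP => i; rewrite uI wI.
by move=> v; rewrite inE => /orP[/eqP ->|/hw].
Qed.

Lemma linked_nf us : sorted (linked) us -> (forall u, u \in us -> red u) ->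
  nf_words us.
Proof.
move=> s r; split=> //; apply: sub_sorted s => u v /linkedP h.
by apply/weightedP => i /h.
Qed.

Lemma is_left_nf_words u us : sorted (linked) (u :: us) ->
  (forall v, v \in u :: us -> red v /\ v != [::]) -> ~ ldvd d u ->
  [/\ ginf (cl (flatten (u :: us))) = 0%R,
    gsup (cl (flatten (u :: us))) = (size us).+1%:Z%R
  & is_left_nf (cl (flatten (u :: us))) (map cl (u :: us))].
Proof.
move=> s hr hu; have nf := linked_nf s (fun v vu => (hr v vu).1).
have inf0 := ginf_nf nf hu.
have sup0 := gsup_nf (isT : (0 < size (u :: us))%N) nf
  (fun v vu => (hr v vu).2).
split=> //; split.
- by rewrite size_map; split=> //; rewrite /glen inf0 sup0 subr0.
- by rewrite inf0 prod_cl mul1g.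
- move=> _ /mapP[v /hr[rv v0] ->]; split; first by apply/simpleP; exists v.
  by rewrite -cl_nil => /cl_beq/beq_size/size0nil v1; rewrite v1 in v0.
- by rewrite /= DeltaE => /cl_beq h; apply: hu; exists [::]; rewrite cats0.
- move=> i; rewrite size_map => si; rewrite !(nth_map [::]) //; last exact: ltnW.
  apply/left_weightedP; try exact/(hr _ _).1/mem_nth/ltnW.
    exact/(hr _ _).1/mem_nth.
  by case: nf => /(sortedP [::])/(_ i si).
Qed.

Lemma is_right_nf_words us : (0 < size us)%N ->
  sorted (linked) us -> (forall v, v \in us -> red v /\ v != [::]) ->
  ~ ldvd d (last [::] us) -> is_left_nf (cl (flatten us)) (map cl us) ->
  ginf (cl (flatten us)) = 0%R -> is_right_nf (cl (flatten us)) (map cl us).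
Proof.
move=> us0 s hr hl [h1 h2 h3 h4 h5] inf0; split=> //.
- by rewrite inf0 prod_cl mulg1.
- rewrite DeltaE -cl_nil last_map => /cl_beq h; apply: hl.
  by exists [::]; rewrite cats0.
- move=> i; rewrite size_map => si; rewrite !(nth_map [::]) //; last exact: ltnW.
  apply/right_weightedP; try exact/(hr _ _).1/mem_nth/ltnW.
    exact/(hr _ _).1/mem_nth.
  by move/(sortedP [::]): s => /(_ i si)/linkedP h j /h.
Qed.

Lemma left_nf_unique (x : G) us : is_left_nf x (map cl us) -> nf_words us ->
  left_nf x = map cl us.
Proof.
move=> nfx nu; apply: xget_unique => // ys nfy.
have [vs ey nv] := left_nf_words nfy.
rewrite ey in nfy *; apply: (nf_words_uniq) => //.
  case: nfx nfy => [[_ e1] _ _ _ _] [[_ e2] _ _ _ _].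
  by move: e2; rewrite e1 !size_map => -[].
case: nfx nfy => [_ e1 _ _ _] [_ e2 _ _ _].
apply/cl_beq; rewrite -!prod_cl; apply: (mulgI (expgz (Delta M) (ginf x))).
by rewrite -e1 -e2.
Qed.

(** Some bond is at least 3, so Delta has at least three letters; hence b^-1 Delta is not an
    atom. *)
Lemma size_longest : (2 < size d)%N.
Proof.
case: hM => _ _ _ _ [i [j [ij Mij]]]; have m2 := bond_ge2 ij.
have m3 : (3 <= bond i j)%N.
  rewrite ltn_neqAle m2 andbT; apply: contra_notN Mij => /eqP e.
  by rewrite bondE // -e.
have /redP[y /beq_size ->] := red_alt ij m3.
by rewrite size_cat size_alt; lia.
Qed.

(** As Delta is its own reverse, the mirror image of b^-1 Delta is Delta b^-1, which equals
    tau(b)^-1 Delta. *)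
Lemma conj_complement b u : d ~ b :: u -> conjd b :: rev u ~ d.
Proof.
move=> du; apply: (@beq_cancelr [:: b]).
rewrite !cats1 conjdPr rcons_cons; apply: cons_beq => //.
have := beq_rev du; rewrite rev_cons => <-.
exact: beq_rev_longest.
Qed.

Lemma blocking_words : irreducible_type M -> exists a b B mid1 mid2,
  let us := [:: a] :: mid1 ++ [:: B; rev B] ++ rcons mid2 [:: a] in
  [/\ d ~ b :: B, size mid1 = size mid2, sorted (linked) us,
      forall u, u \in us -> red u
    & forall u, u \in mid1 ++ [:: B; rev B] ++ mid2 -> (2 <= size u)%N].
Proof.
move=> irr; have n2 : (2 <= n)%N by case: hM.
pose b : 'I_n := Ordinal (ltnW n2).
have /redP[B dB] : red [:: b] by exact: red1.
have rB : red B by apply: (@red_catr [:: b]); exact: beq_red dB rd.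
have descB : rdesc (rev B) [set~ b].
  move=> i; rewrite red_rcons_rev revK !inE negbK; split=> [ri|/eqP ->]; last first.
    exact: beq_red dB rd.
  apply: contraPT ri => ib ri; have /redP[y dy] : red [:: i] by exact: red1.
  have bi : b != i by rewrite eq_sym.
  (* Both b and i divide Delta, so [B] begins with what remains of their lcm after b, a non-empty
     word starting with i. *)
  have := beq_head (beq_trans (beq_sym dB) dy); rewrite /= (negbTE bi).
  case=> w [Bw _]; have m2 := bond_ge2 bi.
  have /(left_descentP i rB) : ldvd [:: i] B.
    have e : (bond b i).-1 = (bond b i).-2.+1 by lia.
    by rewrite e altS in Bw; exists (alternating b i (bond b i).-2 ++ w).
  by case.
have [a sa] : exists a, slides (coxeter_edge M) [set~ b] [set a].
  apply: (slides_singleton (edge_sym)) => //.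
  - by move=> i; rewrite /coxeter_edge eqxx.
  - apply/set0Pn; exists (Ordinal n2); rewrite !inE; apply/eqP.
    by move/(congr1 val).
  - by apply/eqP => /setP/(_ b); rewrite !inE eqxx.
have [ws [pw hw la]] := slides_words sa descB.
pose K := rcons ws [:: a].
have usE : [:: a] :: rev (map rev ws) ++ [:: B; rev B] ++ K =
    rev (map rev K) ++ B :: rev B :: K.
  by rewrite {2}/K map_rcons rev_rcons.
(* The last link holds because the slides end at the descent set {a}, which is the left descent set
   of the atom a. *)
have pK : path (linked) (rev B) K.
  rewrite rcons_path pw; apply/linkedP => i; rewrite la inE.
  split=> [ia|rai]; last first.
    by apply/eqP => ia; rewrite ia in rai; case: (nred_double rai).
  by apply: (red_alt ia (l := 2)); exact: bond_ge2.
have redK u : u \in K -> red u.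
  by rewrite mem_rcons inE => /orP[/eqP ->|/hw[] //]; exact: red1.
exists a, b, B, (rev (map rev ws)), ws; rewrite -/K usE; split.
- exact: dB.
- by rewrite size_rev size_map.
- rewrite sorted_cat_cons /= pK andbT.
  (* The left half is the mirror image of the right half, and reversal preserves links; the middle
     pair [B], [rev B] is its own mirror image. *)
  have -> : rcons (rev (map rev K)) B = rev (map rev (rev B :: K)).
    by rewrite /= rev_cons revK.
  rewrite rev_sorted sorted_map; apply/andP; split.
    by apply: sub_path pK => u v; exact: linked_rev.
  by apply/linkedP => i; rewrite red_rcons_rev.
- move=> u; rewrite mem_cat mem_rev !inE.
  case/or3P => [|/eqP -> //|/orP[/eqP ->|/redK //]].
    by case/mapP => v /redK/red_rev rv ->.
  exact: red_rev.
- have B2 : (2 <= size B)%N by have := size_longest; rewrite (beq_size dB) /=.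
  move=> u; rewrite !mem_cat mem_rev !inE => /or3P[|/orP[] /eqP ->|/hw[] //].
  + by case/mapP => v /hw[_ sv] ->; rewrite size_rev.
  + exact: B2.
  + by rewrite size_rev.
Qed.

End SphericalArtin.

Theorem proposition3p1 (n : nat) (M : 'M[option nat]_n)
    (hM : is_coxeter_matrix M) (hirr : irreducible_type M)
    (hsph : spherical_type M) :
  exists a b xG : artin M, exists nf : seq (artin M),
    atoms a /\ atoms b /\ ginf xG = 0%R /\
    (is_left_nf xG nf /\ is_right_nf xG nf) /\
    (initial_factor xG = a /\ final_factor xG = a /\
     forall i : nat, (i < size nf)%N ->
       (atoms (nth 1 nf i) <-> i = 0%N \/ i = (size nf).-1)) /\
    (exists i : nat, (i.+1 < size nf)%N /\
       nth 1 nf i = b^-1 * Delta M /\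
       nth 1 nf i.+1 = tau b^-1 * Delta M) /\
    (((order_tau M)%:Z%R %| gsup xG)%Z /\
     (forall y : artin M, tauz (gsup xG) y = y) /\
     (forall y : artin M, commute (expgz (Delta M) (gsup xG)) y)).
Proof.
have [d [rd _ /(_ _ isT) nd _]] := longest_red hsph predT.
have nd' i : ~ red M (i :: d) by exact: nd.
have [a [b [B [mid1 [mid2 [dB sz srt rall big]]]]]] :=
  blocking_words hM hsph rd nd' hirr.
set us' := mid1 ++ _ in srt rall; pose us := [:: a] :: us'.
have usE : us = rcons ([:: a] :: mid1 ++ [:: B; rev B] ++ mid2) [:: a].
  by rewrite /us /us' /= rcons_cat.
have ne u : u \in us -> red M u /\ u != [::].
  move=> uus; split; first exact: rall.
  move: uus; rewrite usE mem_rcons !inE orbA orbb => /orP[/eqP -> //|/big].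
  by case: (u).
have sa : size [:: a] = 1%N by [].
have da : ~ ldvd M d [:: a].
  case=> r /beq_size; rewrite size_cat; have := size_longest hM hsph rd nd'.
  by rewrite /=; lia.
have [inf0 sup0 lnf] := is_left_nf_words hM hsph rd nd' srt ne da.
have rnf : is_right_nf (cl M (flatten us)) (map (cl M) us).
  apply: (is_right_nf_words hM hsph rd nd') => //.
  by rewrite usE last_rcons.
(* Two atoms, two middle factors and twice [size mid2] further ones: the length is even. *)
have szu : size us = ((size mid2).+2).*2.
  by rewrite usE size_rcons /= !size_cat /= sz; lia.
have lE := left_nf_unique hM hsph rd nd' lnf (linked_nf srt rall).
rewrite -/us in inf0 sup0 lnf lE.
have supE : gsup (cl M (flatten us)) = ((size mid2).+2).*2%:Z%R.
  by rewrite sup0 -szu.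
exists (gen M a), (gen M b), (cl M (flatten us)), (map (cl M) us).
have szn : size (map (cl M) us) = size us by rewrite size_map.
split; first by exists a.
split; first by exists b.
split; first exact: inf0.
split; first by split.
split; [split; last split|split].
- by rewrite /initial_factor lE inf0 oppr0 /= cl1.
- by rewrite /final_factor lE usE map_rcons last_rcons cl1.
- rewrite szn => i iu; rewrite (nth_map [::]) //; split; last first.
    case=> ->; first by exists a; rewrite //= cl1.
    by exists a; rewrite // nth_last usE last_rcons cl1.
  (* An atom is a single letter, whereas every factor other than the first and the last has at least
     two. *)
  move=> [j _]; rewrite -cl1 => /(cl_beq hM hsph rd nd')/beq_size s1.
  case: i iu s1 => [|i] iu s1; first by left.
  right; apply: contrapT => /eqP il.
  have im : (i < size (mid1 ++ [:: B; rev B] ++ mid2))%N.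
    by move: iu il; rewrite usE size_rcons /=; lia.
  have := big _ (mem_nth [::] im); move: s1.
  by rewrite usE nth_rcons /= ltnS im => <-.
- exists (size mid1).+1.
  have iu : ((size mid1).+2 < size us)%N by rewrite szu sz; lia.
  rewrite szn; split=> //; rewrite !(nth_map [::]) ?(ltnW iu) //.
  have nB : nth [::] us (size mid1).+1 = B by rewrite /= nth_cat ltnn subnn.
  have nB' : nth [::] us (size mid1).+2 = rev B.
    by rewrite /= nth_cat ltnNge leqnSn /= subSnn.
  rewrite nB nB' (DeltaE hM hsph rd nd'); split.
    rewrite (proj2 (cl_beq hM hsph rd nd' _ _) dB) cl_cons mulKg //.
  have -> : tau (gen M b)^-1 = (tau (gen M b))^-1.
    by rewrite /tau !invgM invgK mulgA.
  rewrite (tau_gen hM hsph rd nd').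
  apply: (mulgI (gen M (conjd hM hsph rd nd' b))); rewrite mulVKg -cl_cons.
  by apply/(cl_beq hM hsph rd nd'); exact: (conj_complement hM hsph rd nd' dB).
- rewrite supE; split.
    by rewrite dvdzE /=; exact: (order_tau_even hM hsph rd nd').
  split=> y; first exact: (iter_tau_double hM hsph rd nd').
  rewrite /= -muln2 mulnC expgnA; apply/commute_sym/commuteX.
  rewrite (DeltaE hM hsph rd nd') expg2 -cl_cat; apply: commute_sym.
  exact: (cl_dd_central hM hsph rd nd').
Qed.
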